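(* Let $Q$ be a concave BUM function, let $C_1,\dots,C_n$ be independent with $C_i$ uniformly distributed on $[\underline{c}_i,\overline{c}_i]$, $\underline{c}_i\ge 0$, let $\hat{c}_i=\mathbb{E}[C_i]$, and let $\gamma\ge\frac12$ be a constant such that $\hat{c}_i\ge\gamma(\overline{c}_i-\underline{c}_i)$ for each $i\in\{1,\dots,n\}$. Let $$\beta^{(1)}_B=\frac13\int_0^1\ln t^{-1}\,dQ(t),\qquad \beta^{(2)}_B=\frac{1}{\sqrt6}\int_0^1\sqrt{\ln t^{-1}}\,dQ(t).$$ If $\beta^{(1)}_B$, $\beta^{(2)}_B$ and an optimal solution to the problem $$\begin{array}{lll}\min & \hat{\boldsymbol{c}}^\top\boldsymbol{x}+\beta^{(1)}_B\,t+\beta^{(2)}_B\sqrt{\sum_{i=1}^n(\overline{c}_i-\underline{c}_i)^2x_i^2}\\ \text{s.t.}& t\ge(\overline{c}_i-\underline{c}_i)x_i, & i\in\{1,\dots,n\},\\ &\boldsymbol{x}\in\mathcal{X},\ t\in\mathbb{R}\end{array}$$ can be computed in polynomial time, then the problem $\min_{\boldsymbol{x}\in\mathcal{X}}\rho_Q(\boldsymbol{C}^\top\boldsymbol{x})$ is approximable within $1+(\beta^{(1)}_B+\beta^{(2)}_B)/\gamma$.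
   Context: A basic unit monotone (BUM) function is a function $Q:[0,1]\to[0,1]$ with $Q(0)=0$, $Q(1)=1$ and $Q(x)\ge Q(y)$ for $x>y$. For a random variable $Y$ with CDF $F_Y$, $\mathrm{VaR}_t(Y)=\inf\{y\in\mathbb{R}: F_Y(y)\ge t\}$ for $t\in(0,1]$ and $\mathrm{VaR}_0(Y)=\inf\{y\in\mathbb{R}:F_Y(y)>0\}$. The distortion risk measure is the Riemann–Stieltjes integral $\rho_Q(Y)=\int_0^1 \mathrm{VaR}_{1-t}(Y)\,dQ(t)$. $\mathcal{X}\subseteq\mathbb{R}^n_+$ is a set of feasible solutions, $\boldsymbol{C}=(C_1,\dots,C_n)^\top$ and $\hat{\boldsymbol{c}}=(\hat{c}_1,\dots,\hat{c}_n)$. The integrals defining $\beta^{(1)}_B,\beta^{(2)}_B$ are (possibly improper) Stieltjes integrals with values in $[0,+\infty]$, the integrands being $+\infty$ at $t=0$ (so a jump of $Q$ at $0$ makes them infinite); they are assumed finite. A problem $\min_{\boldsymbol{x}\in\mathcal{X}}f(\boldsymbol{x})$ is approximable within $\kappa$ if there is a polynomial-time algorithm that outputs $\boldsymbol{x}^*\in\mathcal{X}$ with $f(\boldsymbol{x}^* )\le\kappa f(\boldsymbol{x})$ for all $\boldsymbol{x}\in\mathcal{X}$. *)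

(* Defs.v *)
From HB Require Import structures.
From mathcomp Require Import all_boot all_order all_algebra.
From mathcomp Require Import all_classical all_reals all_analysis.

Set Implicit Arguments.
Unset Strict Implicit.
Unset Printing Implicit Defensive.

Import Order.TTheory GRing.Theory Num.Theory.
Import numFieldNormedType.Exports.

Local Open Scope classical_set_scope.
Local Open Scope ring_scope.

Section Stieltjes.
Context {R : realType}.

Definition tagged_partition (a b : R) (m : nat) (t xi : nat -> R) : Prop :=
  [/\ t 0%N = a, t m = b &
      forall k, (k < m)%N -> t k <= xi k <= t k.+1].

Definition stieltjes_sum (f g : R -> R) (m : nat) (t xi : nat -> R) : R :=
  \sum_(k < m) f (xi k) * (g (t k.+1) - g (t k)).

Definition is_stieltjes (f g : R -> R) (a b l : R) : Prop :=
  forall e : R, 0 < e -> exists2 delta : R, 0 < delta &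
    forall m t xi, tagged_partition a b m t xi ->
      (forall k, (k < m)%N -> t k.+1 - t k < delta) ->
      `|stieltjes_sum f g m t xi - l| < e.

(* Riemann-Stieltjes integral of f against g on [a, b]; 0 if it does not
   exist. *)
Definition stieltjes (f g : R -> R) (a b : R) : R := xget 0 (is_stieltjes f g a b).

(* Stieltjes integral on [0, 1] of a function which may be +oo at 0 (and only
   there): the jump of g at 0 is multiplied by f 0, with +oo * 0 = 0, and the
   rest is the improper integral over ]0, 1]. *)
Definition improper_stieltjes (f : R -> \bar R) (g : R -> R) : \bar R :=
  (f 0%R * (lim (g t @[t --> 0^'+]) - g 0)%R%:E
   + lim ((stieltjes (fine \o f) g e 1)%:E @[e --> 0^'+]))%E.

End Stieltjes.

Section Distortion.
Context {R : realType}.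

(* A function on [0, 1] is represented by a function on R of which only the
   restriction to [0, 1] matters; that the values lie in [0, 1] follows from
   the three conditions. *)
Definition BUM (Q : R -> R) : Prop :=
  [/\ Q 0 = 0, Q 1 = 1 &
      forall x y, 0 <= y -> y < x -> x <= 1 -> Q y <= Q x].

Definition concave_unit (Q : R -> R) : Prop :=
  forall x y t, 0 <= x <= 1 -> 0 <= y <= 1 -> 0 <= t <= 1 ->
    t * Q x + (1 - t) * Q y <= Q (t * x + (1 - t) * y).

(* The infima are taken in R; they are the intended ones for t in ]0, 1[, and
   also for t = 0 and t = 1 when Y is essentially bounded. *)
Definition VaR d (T : measurableType d) (P : probability T R)
    (Y : {RV P >-> R}) (t : R) : R :=
  if 0 < t then inf [set y : R | (t%:E <= cdf Y y)%E]
  else inf [set y : R | (0 < cdf Y y)%E].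

Definition distortion_risk d (T : measurableType d) (P : probability T R)
    (Q : R -> R) (Y : {RV P >-> R}) : R :=
  stieltjes (fun t => VaR Y (1 - t)) Q 0 1.

Definition ln_inv (t : R) : \bar R :=
  if t == 0 then +oo%E else (ln t^-1)%:E.

Definition beta1 (Q : R -> R) : \bar R :=
  ((3^-1)%R%:E * improper_stieltjes ln_inv Q)%E.

Definition beta2 (Q : R -> R) : \bar R :=
  ((Num.sqrt 6)^-1%R%:E * improper_stieltjes (fun t => sqrte (ln_inv t)) Q)%E.

End Distortion.

Section RandomCosts.
Context {R : realType} {d : measure_display} {T : measurableType d}.
Context {P : probability T R}.

Definition independent_RVs n (C : 'I_n -> {RV P >-> R}) : Prop :=
  forall (J : {set 'I_n}) (B : 'I_n -> set R), (forall i, measurable (B i)) ->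
    P (\bigcap_(i in [set i | i \in J]) C i @^-1` B i)
    = (\prod_(i in J) P (C i @^-1` B i))%E.

(* The uniform law on the degenerate interval [a, a] is the point mass at a. *)
Definition uniform_RV (X : {RV P >-> R}) (a b : R) : Prop :=
  [/\ a <= b,
      forall (ab : a < b) (A : set R), measurable A ->
        distribution P X A = uniform_prob ab A &
      a = b -> forall A : set R, measurable A ->
        distribution P X A = \d_a A].

Definition mean (X : {RV P >-> R}) : R := fine 'E_P[X].

Definition total_cost n (C : 'I_n -> {RV P >-> R}) (x : 'rV[R]_n)
  : {RV P >-> R} := \sum_(i < n) x 0 i *: C i.

End RandomCosts.

Section TuringMachines.

Definition word := seq bool.

Inductive move := MoveLeft | Stay | MoveRight.

(* Deterministic Turing machine with one input tape (tape 0), m output tapes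
   (tapes 1, ..., m) and tm_work work tapes, all infinite to the right, over
   the alphabet {blank, 0, 1} where blank is None. *)
Record machine (m : nat) := Machine {
  tm_work : nat;
  tm_state : finType;
  tm_init : tm_state;
  tm_halt : pred tm_state;
  tm_delta : tm_state -> {ffun 'I_(m + tm_work).+1 -> option bool} ->
             tm_state * {ffun 'I_(m + tm_work).+1 -> option bool * move} }.

Variables (m : nat) (M : machine m).

Definition tape := 'I_(m + tm_work M).+1.

Record config := Config {
  cf_state : tm_state M;
  cf_cell : tape -> nat -> option bool;
  cf_head : tape -> nat }.

Definition move_head (mv : move) (h : nat) : nat :=
  match mv with MoveLeft => h.-1 | Stay => h | MoveRight => h.+1 end.

Definition tm_step (c : config) : config :=
  if tm_halt (cf_state c) then c else
  let a := tm_delta (cf_state c) [ffun j : tape => cf_cell c j (cf_head c j)] in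
  {| cf_state := a.1;
     cf_cell := fun j k =>
       if k == cf_head c j then (a.2 j).1 else cf_cell c j k;
     cf_head := fun j => move_head (a.2 j).2 (cf_head c j) |}.

Definition tm_start (w : word) : config :=
  {| cf_state := tm_init M;
     cf_cell := fun j => if j == ord0 then onth w else fun=> None;
     cf_head := fun=> 0%N |}.

Definition output_tape (j : 'I_m) : tape := lift ord0 (lshift (tm_work M) j).

(* On input w, M halts after at most s steps, and then each output tape j
   contains exactly the word v j, followed by blanks. *)
Definition outputs_within (w : word) (s : nat) (v : 'I_m -> word) : Prop :=
  let c := iter s tm_step (tm_start w) in
  tm_halt (cf_state c) /\
  forall j k, cf_cell c (output_tape j) k = onth (v j) k.

End TuringMachines.

(* Search problem with instances I, input words enc i, and acceptable m-tuples
   of output words spec i. *)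
Definition polytime_computable (I : Type) (enc : I -> word) (m : nat)
    (spec : I -> ('I_m -> word) -> Prop) : Prop :=
  exists (M : machine m) (p : {poly nat}), forall i,
    exists2 v : 'I_m -> word,
      outputs_within M (enc i) p.[size (enc i)] v & spec i v.

(* How words denote real numbers and real vectors; a word may denote nothing,
   and an object may have several names or none. *)
Record notation_system (R : realType) := NotationSystem {
  real_of : word -> option R;
  vec_of : forall n, word -> option 'rV[R]_n }.

Definition approximable (R : realType) (N : notation_system R)
    (I : Type) (enc : I -> word) (n : I -> nat)
    (X : forall i, set 'rV[R]_(n i)) (f : forall i, 'rV[R]_(n i) -> R)
    (kappa : I -> R) : Prop :=
  polytime_computable enc (fun i (v : 'I_1 -> word) =>
    exists x : 'rV[R]_(n i),
      [/\ vec_of N (n i) (v ord0) = Some x, X i x &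
          forall y, X i y -> f i x <= kappa i * f i y]).

Definition polytime_real (R : realType) (N : notation_system R)
    (I : Type) (enc : I -> word) (a : I -> R) : Prop :=
  polytime_computable enc (fun i (v : 'I_1 -> word) =>
    real_of N (v ord0) = Some (a i)).

Record instance (R : realType) := Instance {
  nvar : nat;
  feasible : set 'rV[R]_nvar;
  distortion : R -> R;
  c_low : 'I_nvar -> R;
  c_up : 'I_nvar -> R;
  disp : measure_display;
  sample : measurableType disp;
  prob : probability sample R;
  cost : 'I_nvar -> {RV prob >-> R} }.

Section Problems.
Context {R : realType}.
Variable p : instance R.

Definition c_hat (i : 'I_(nvar p)) : R := mean (cost i).

Definition surrogate_feasible (x : 'rV[R]_(nvar p)) (t : R) : Prop :=
  feasible x /\ forall i, (c_up i - c_low i) * x 0 i <= t.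

Definition surrogate_objective (x : 'rV[R]_(nvar p)) (t : R) : R :=
  \sum_(i < nvar p) c_hat i * x 0 i + fine (beta1 (distortion p)) * t
  + fine (beta2 (distortion p))
    * Num.sqrt (\sum_(i < nvar p) (c_up i - c_low i) ^+ 2 * (x 0 i) ^+ 2).

Definition surrogate_optimal (x : 'rV[R]_(nvar p)) (t : R) : Prop :=
  surrogate_feasible x t /\
  forall y s, surrogate_feasible y s ->
    surrogate_objective x t <= surrogate_objective y s.

Definition risk_objective (x : 'rV[R]_(nvar p)) : R :=
  distortion_risk (distortion p) (total_cost (@cost R p) x).

End Problems.

Definition polytime_surrogate_optimal (R : realType) (N : notation_system R)
    (I : Type) (enc : I -> word) (inst : I -> instance R) : Prop :=
  polytime_computable enc (fun i (v : 'I_2 -> word) =>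
    exists (x : 'rV[R]_(nvar (inst i))) (t : R),
      [/\ vec_of N (nvar (inst i)) (v ord0) = Some x,
          real_of N (v ord_max) = Some t &
          surrogate_optimal x t]).

(* Main.v *)
Require Import Defs.
From HB Require Import structures.
From mathcomp Require Import all_boot all_order all_algebra.
From mathcomp Require Import all_classical all_reals all_analysis.
From mathcomp Require Import measurable_realfun ring lra zify.

Set Implicit Arguments.
Unset Strict Implicit.
Unset Printing Implicit Defensive.

Import Order.TTheory GRing.Theory Num.Theory.
Import numFieldNormedType.Exports.

Local Open Scope classical_set_scope.
Local Open Scope ring_scope.

(** If [Y = C^T x] with independent [C_j] uniform on intervals of length [w_j], then
    [sinh u / u <= exp (u^2 / 6)] gives
    [E exp (l (Y - E Y)) <= exp (l^2 S / 24)] with [S = \sum_j w_j^2 x_j^2], so that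
    Chernoff's bound yields [VaR_(1-t) Y <= E Y + sqrt (S / 6) * sqrt (ln (1 / t))].
    Integrating against [dQ], [rho_Q Y <= E Y + beta2 * sqrt S], which is at most the
    surrogate objective since [beta1 * t >= 0].  Conversely [Q t >= t] for concave [Q], and a
    summation by parts gives [E Y <= rho_Q Y].  The surrogate objective at a feasible [y]
    with [t = \sum_j w_j y_j] is at most
    [(1 + (beta1 + beta2) / gamma) * E (C^T y)].

    Finiteness of [beta1] or [beta2] forces [Q] to be continuous at 0, hence, as a concave [Q]
    is subadditive, uniformly continuous on [0, 1]; this is what makes the Stieltjes
    integrals of monotone functions exist. *)

(** * Turing machines *)

(** The approximation algorithm is the machine for the surrogate problem itself, read on its first
    output tape only. *)
Lemma polytime_computable_fst (I : Type) (enc : I -> word)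
    (spec : I -> ('I_2 -> word) -> Prop) (spec' : I -> ('I_1 -> word) -> Prop) :
  (forall i v, spec i v -> spec' i (fun=> v ord0)) ->
  polytime_computable enc spec -> polytime_computable enc spec'.
Proof.
move=> spec_imp [[w st ini hlt dl] [p Mp]].
(* The second output tape becomes a work tape: both machines have tapes
   ['I_w.+3], by conversion. *)
pose M2 := @Machine 2 w st ini hlt dl.
pose M1 := @Machine 1 w.+1 st ini hlt dl.
pose forget (c : config M2) : config M1 :=
  @Config 1 M1 (cf_state c) (cf_cell c) (cf_head c).
have stepE c : tm_step (forget c) = forget (tm_step c).
  by rewrite /tm_step /=; case: ifP.
have iterE s c : iter s (@tm_step 1 M1) (forget c) = forget (iter s (@tm_step 2 M2) c).
  by elim: s => //= s ->; rewrite stepE.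
exists M1, p => i; have [v [halt out] sv] := Mp i.
exists (fun=> v ord0); last exact: spec_imp.
rewrite /outputs_within -[tm_start M1 _]/(forget (tm_start M2 (enc i))) iterE.
split; first exact: halt.
move=> j k; rewrite (ord1 j) -(out ord0 k).
congr (cf_cell _ _ _); exact: val_inj.
Qed.

(** * Riemann-Stieltjes integrals of monotone functions *)

Section StieltjesTheory.
Context {R : realType}.
Implicit Types (f g h : R -> R) (a b c l : R) (m n : nat) (s t xi : nat -> R).

Definition nonincr_on f a b := forall x y, a <= x -> x <= y -> y <= b -> f y <= f x.
Definition nondecr_on g a b := forall x y, a <= x -> x <= y -> y <= b -> g x <= g y.
(** For nondecreasing [g] this is uniform continuity on [[a, b]]. *)
Definition small_increments g a b := forall e, 0 < e -> exists2 delta, 0 < delta &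
  forall x y, a <= x -> x <= y -> y <= b -> y - x < delta -> g y - g x < e.

(** Projection onto [[a, b]] when [a <= b]; it expresses increments over intersections of
    intervals. *)
Definition clamp a b x : R := Num.max a (Num.min b x).

Lemma clampL a b x : a <= b -> x <= a -> clamp a b x = a.
Proof. by move=> ab xa; rewrite /clamp min_r ?max_l ?(le_trans xa ab). Qed.

Lemma clampR a b x : a <= b -> b <= x -> clamp a b x = b.
Proof. by move=> ab bx; rewrite /clamp min_l ?max_r. Qed.

(** Both sides are the increment of [g] over the intersection of [[a, b]] and [[c, d]], and vanish
    if these are disjoint. *)
Lemma clampC g a b c d : a <= b -> c <= d ->
  g (clamp a b d) - g (clamp a b c) = g (clamp c d b) - g (clamp c d a).
Proof.
move=> ab cd; have [ad|/ltW da] := leP a d; last first.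
  have ca := le_trans cd da; have db := le_trans da ab.
  by rewrite (clampL ab da) (clampL ab ca) (clampR cd db) (clampR cd da) !subrr.
have [cb|/ltW bc] := leP c b; last first.
  have bd := le_trans bc cd; have ac := le_trans ab bc.
  by rewrite (clampR ab bd) (clampR ab bc) (clampL cd bc) (clampL cd ac) !subrr.
rewrite /clamp (min_r cb) (min_r ad) (maxC c a).
by rewrite (minC d b) !(@max_r _ _ _ (Num.min b d)) ?le_min ?ab ?ad ?cb ?cd.
Qed.

Lemma tagged_partition_mono a b m t xi : tagged_partition a b m t xi ->
  forall i j, (i <= j)%N -> (j <= m)%N -> t i <= t j.
Proof.
move=> [_ _ txi] i j ij; elim: j ij => [|j IH]; first by rewrite leqn0 => /eqP ->.
rewrite leq_eqVlt => /predU1P[->//|]; rewrite ltnS => ij jm.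
by rewrite (le_trans (IH ij (ltnW jm)))//; have /andP[/le_trans] := txi j jm; apply.
Qed.

Lemma tagged_partition_bounds a b m t xi : tagged_partition a b m t xi ->
  forall i, (i <= m)%N -> a <= t i <= b.
Proof.
move=> p i im; have [t0 tm _] := p; have mono := tagged_partition_mono p.
by rewrite -t0 -tm !mono.
Qed.

Lemma tagged_partition_tags a b m t xi xi' : tagged_partition a b m t xi ->
  (forall k, (k < m)%N -> t k <= xi' k <= t k.+1) -> tagged_partition a b m t xi'.
Proof. by move=> [t0 tm _]. Qed.

Lemma tagged_partition_left a b m t xi :
  tagged_partition a b m t xi -> tagged_partition a b m t t.
Proof.
move=> p; apply: (tagged_partition_tags p) => k km.
by rewrite lexx (tagged_partition_mono p).
Qed.

(** As [f] is nonincreasing, right tags give lower Darboux sums and left tags upper ones. Where an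
    interval of [s] meets one of [t], the right end of the former is not before the left end of the
    latter. *)
Lemma lower_le_upper_sum f g a b m n s t xi xi' :
  nonincr_on f a b -> nondecr_on g a b ->
  tagged_partition a b m s xi -> tagged_partition a b n t xi' ->
  stieltjes_sum f g m s (s \o succn) <= stieltjes_sum f g n t t.
Proof.
move=> fni gnd ps pt; have [s0 sm _] := ps; have [t0 tn _] := pt.
have sM := tagged_partition_mono ps; have tM := tagged_partition_mono pt.
have sB := tagged_partition_bounds ps; have tB := tagged_partition_bounds pt.
(* Both sums are refined over the intersections of the intervals of [s] and [t]. *)
pose D k j := g (clamp (s k) (s k.+1) (t j.+1)) - g (clamp (s k) (s k.+1) (t j)).
have DE k : (k < m)%N -> \sum_(j < n) D k j = g (s k.+1) - g (s k).
  move=> km; rewrite -(big_mkord xpredT (D k)) telescope_sumr // t0 tn.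
  have /andP[? _] := sB k (ltnW km); have /andP[_ ?] := sB k.+1 km.
  by rewrite clampR ?clampL ?sM.
have DE' j : (j < n)%N -> \sum_(k < m) D k j = g (t j.+1) - g (t j).
  move=> jn; under eq_bigr do rewrite /D clampC ?sM ?tM //.
  rewrite -(big_mkord xpredT (fun k => g (clamp (t j) (t j.+1) (s k.+1)) -
    g (clamp (t j) (t j.+1) (s k)))).
  rewrite (telescope_sumr (fun k => g (clamp (t j) (t j.+1) (s k)))) // s0 sm.
  have /andP[? _] := tB j (ltnW jn); have /andP[_ ?] := tB j.+1 jn.
  by rewrite clampR ?clampL ?tM.
rewrite /stieltjes_sum; under eq_bigr do rewrite -DE // mulr_sumr.
under [leRHS]eq_bigr do rewrite -DE' // mulr_sumr.
rewrite exchange_big /=; apply: ler_sum => j _; apply: ler_sum => k _.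
have [jk|kj] := leP (t j) (s k.+1); last first.
  have ? : s k.+1 <= t j.+1 by rewrite (le_trans (ltW kj)) ?tM.
  by rewrite /D !clampR ?sM ?(ltW kj)// subrr !mulr0.
have /andP[? _] := tB j (ltnW (ltn_ord j)); have /andP[_ ?] := sB k.+1 (ltn_ord k).
have /andP[? _] := sB k (ltnW (ltn_ord k)).
apply: ler_wpM2r; last exact: fni.
rewrite subr_ge0; apply: gnd.
- by rewrite /clamp le_max; apply/orP; left.
- have /tM /(_ (ltn_ord j)) tt := leqnSn j.
  rewrite /clamp ge_max le_max lexx /= le_max; apply/orP; right.
  by rewrite le_min !ge_min lexx tt orbT.
- by rewrite /clamp ge_max (le_trans (sM _ _ (leqnSn k) _))// ge_min; apply/orP; left.
Qed.

(** The integral is the supremum of the lower sums. It and every tagged sum lie between the lower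
    and the upper sum of the partition, which come close together as the increments of [g]
    shrink. *)
Lemma monotone_is_stieltjes f g a b : a <= b ->
  nonincr_on f a b -> nondecr_on g a b -> small_increments g a b ->
  exists l, is_stieltjes f g a b l.
Proof.
move=> ab fni gnd gsm.
pose lower := [set y | exists m t,
  tagged_partition a b m t t /\ y = stieltjes_sum f g m t (t \o succn)].
pose t1 k := if k is 0%N then a else b.
have p1 : tagged_partition a b 1 t1 t1.
  by split=> // k; rewrite ltnS leqn0 => /eqP ->; rewrite /t1 lexx.
have low_le m t xi y : tagged_partition a b m t xi -> lower y ->
    y <= stieltjes_sum f g m t t.
  by move=> pt [n [s [ps ->]]]; exact: (lower_le_upper_sum fni gnd ps pt).
have low0 : lower !=set0 by exists (stieltjes_sum f g 1 t1 (t1 \o succn)), 1%N, t1.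
exists (sup lower) => e e0.
have fab : 0 <= f a - f b by rewrite subr_ge0 fni.
have fab0 : 0 < f a - f b + 1 by rewrite ltr_wpDl.
(* The differences of [f] telescope to [f a - f b], so this bound on the increments of [g] gives a
   gap below [e]; adding 1 keeps the denominator positive for constant [f]. *)
have [delta d0 gd] := gsm _ (divr_gt0 e0 fab0).
exists delta => // m t xi pt mesh; have [t0 tm txi] := pt.
have tM := tagged_partition_mono pt; have tB := tagged_partition_bounds pt.
have tleft := tagged_partition_left pt.
set U := stieltjes_sum f g m t t; set L := stieltjes_sum f g m t (t \o succn).
have dg k : (k < m)%N -> 0 <= g (t k.+1) - g (t k).
  move=> km; rewrite subr_ge0 gnd ?tM //.
    by have /andP[] := tB k (ltnW km).
  by have /andP[] := tB k.+1 km.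
have LS : L <= stieltjes_sum f g m t xi.
  apply: ler_sum => k _; apply: ler_wpM2r; first exact: dg.
  have /andP[x1 x2] := txi k (ltn_ord k); apply: fni => //.
    by rewrite (le_trans _ x1)//; have /andP[] := tB k (ltnW (ltn_ord k)).
  by have /andP[] := tB k.+1 (ltn_ord k).
have SU : stieltjes_sum f g m t xi <= U.
  apply: ler_sum => k _; apply: ler_wpM2r; first exact: dg.
  have /andP[x1 x2] := txi k (ltn_ord k); apply: fni => //.
    by have /andP[] := tB k (ltnW (ltn_ord k)).
  by rewrite (le_trans x2)//; have /andP[] := tB k.+1 (ltn_ord k).
have Ll : L <= sup lower.
  apply: ub_le_sup; last by exists m, t.
  by exists U => y; exact: low_le pt.
have lU : sup lower <= U by apply: ge_sup => // y; exact: low_le pt.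
have UL : U - L < e.
  rewrite /U /L /stieltjes_sum -sumrB.
  have [m0|m0] := posnP m; first by rewrite m0 big_ord0.
  apply: (@le_lt_trans _ _ (\sum_(k < m) (f (t k) - f (t k.+1)) * (e / (f a - f b + 1)))).
    apply: ler_sum => k _; rewrite -mulrBl; apply: ler_wpM2l.
      rewrite subr_ge0 fni ?tM//.
        by have /andP[] := tB k (ltnW (ltn_ord k)).
      by have /andP[] := tB k.+1 (ltn_ord k).
    apply/ltW/gd; rewrite ?tM ?mesh//.
      by have /andP[] := tB k (ltnW (ltn_ord k)).
    by have /andP[] := tB k.+1 (ltn_ord k).
  rewrite -mulr_suml.
  have -> : \sum_(k < m) (f (t k) - f (t k.+1)) = f a - f b.
    rewrite -opprB -t0 -tm -(telescope_sumr (f \o t) (leq0n m)) big_mkord -sumrN.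
    by apply: eq_bigr => k _; rewrite opprB.
  rewrite mulrCA gtr_pMr // ltr_pdivrMr // mul1r; lra.
rewrite ltr_norml; apply/andP; split; lra.
Qed.

Definition even_partition a b m (k : nat) : R := a + (b - a) * (k%:R / m%:R).

Lemma even_partitionP a b m : (0 < m)%N -> a <= b ->
  tagged_partition a b m (even_partition a b m) (even_partition a b m).
Proof.
move=> m0 ab; rewrite /even_partition; split.
- by rewrite mul0r mulr0 addr0.
- by rewrite divff ?mulr1 ?subrKC // pnatr_eq0 -lt0n.
- move=> k _; rewrite lexx lerD2l ler_wpM2l ?subr_ge0//.
  by rewrite ler_wpM2r ?invr_ge0 ?ler0n// ler_nat.
Qed.

(** The shift to [m.+1] intervals makes the partition nonempty for every [m]. *)
Definition left_sum f g a b m :=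
  stieltjes_sum f g m.+1 (even_partition a b m.+1) (even_partition a b m.+1).

Lemma even_partition_mesh a b e : 0 < e ->
  \forall m \near \oo, forall k, even_partition a b m.+1 k.+1 - even_partition a b m.+1 k < e.
Proof.
move=> e0; exists (Num.truncn `|(b - a) / e|) => // m /= em k.
rewrite /even_partition opprD addrACA subrr add0r -mulrBr -mulrBl -natrB//.
rewrite subSnn mul1r ltr_pdivrMr// -ltr_pdivrMl// mulrC.
rewrite (le_lt_trans (ler_norm _))// (lt_le_trans (truncnS_gt _))//.
by rewrite ler_nat ltnS.
Qed.

Lemma left_sum_cvg f g a b l : a <= b -> is_stieltjes f g a b l ->
  left_sum f g a b m @[m --> \oo] --> l.
Proof.
move=> ab fl; apply/cvgrPdist_lt => e e0; have [d d0 dl] := fl e e0.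
have := even_partition_mesh a b d0; apply: filterS => m mesh.
rewrite distrC; apply: dl => [|k _]; last exact: mesh.
exact: even_partitionP.
Qed.

(** The value picked by [xget] is determined, since the left sums over even partitions converge to
    every candidate. *)
Lemma stieltjesE f g a b l : a <= b -> is_stieltjes f g a b l ->
  stieltjes f g a b = l.
Proof.
move=> ab fl; rewrite /stieltjes; case: xgetP => [y _ fy|/(_ l)//].
exact: (cvg_unique _ (left_sum_cvg ab fy) (left_sum_cvg ab fl)).
Qed.

(** Even partitions of the two pieces concatenate to a partition of [[a, c]] with vanishing mesh, so
    both sides are limits of the same sums. *)
Lemma is_stieltjes_cat f g a b c l l1 l2 : a <= b -> b <= c ->
  is_stieltjes f g a c l -> is_stieltjes f g a b l1 -> is_stieltjes f g b c l2 ->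
  l = l1 + l2.
Proof.
move=> ab bc fl fl1 fl2.
suff : (left_sum f g a b m + left_sum f g b c m) @[m --> \oo] --> l.
  move/cvg_unique; apply => //.
  by apply: cvgD; [exact: left_sum_cvg fl1|exact: left_sum_cvg fl2].
apply/cvgrPdist_lt => e e0; have [d d0 dl] := fl e e0.
near=> m.
have sd : forall k, even_partition a b m.+1 k.+1 - even_partition a b m.+1 k < d.
  by near: m; exact: even_partition_mesh.
have td : forall k, even_partition b c m.+1 k.+1 - even_partition b c m.+1 k < d.
  by near: m; exact: even_partition_mesh.
set s := even_partition a b m.+1; set t := even_partition b c m.+1.
pose u k := if (k <= m.+1)%N then s k else t (k - m.+1)%N.
have [s0 sm sM] : tagged_partition a b m.+1 s s by exact: even_partitionP.
have [t0 tm tM] : tagged_partition b c m.+1 t t by exact: even_partitionP.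
have ul k : (k <= m.+1)%N -> u k = s k by move=> km; rewrite /u km.
have ur k : u (m.+1 + k)%N = t k.
  rewrite /u -{2}(addn0 m.+1) leq_add2l leqn0 addKn.
  by case: eqP => // ->; rewrite addn0 t0 sm.
have -> : left_sum f g a b m + left_sum f g b c m = stieltjes_sum f g (m.+1 + m.+1) u u.
  rewrite /stieltjes_sum big_split_ord /=; congr (_ + _); apply: eq_bigr => k _.
    by rewrite !ul // ltnW.
  by rewrite -addnS !ur.
rewrite distrC; apply: dl.
  split; first by rewrite ul.
    by rewrite ur.
  move=> k; have [km _|mk] := ltnP k m.+1.
    by rewrite !ul ?(ltnW km)//; exact: sM.
  by rewrite -(subnKC mk) ltn_add2l -addnS !ur; exact: tM.
move=> k; have [km _|mk] := ltnP k m.+1; first by rewrite !ul ?(ltnW km).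
by rewrite -(subnKC mk) ltn_add2l -addnS !ur.
Unshelve. all: by end_near. Qed.

(** Left sums are compared term by term. Their tags stay strictly below [b], so a bound on [[a, b[]
    suffices; with [b = 1] this avoids the value at risk at level 0. *)
Lemma is_stieltjes_le_affine f h g a b l l' mu c : a < b ->
  is_stieltjes f g a b l -> is_stieltjes h g a b l' -> nondecr_on g a b ->
  (forall x, a <= x < b -> f x <= mu + c * h x) -> l <= mu * (g b - g a) + c * l'.
Proof.
move=> ab fl hl' gnd fh; have lc := left_sum_cvg (ltW ab) fl.
have lc' : (mu * (g b - g a) + c * left_sum h g a b m) @[m --> \oo] -->
    mu * (g b - g a) + c * l'.
  by apply: cvgD; [exact: cvg_cst|apply: cvgMr; exact: left_sum_cvg (ltW ab) hl'].
apply: (ler_cvg_to lc lc'); near=> m.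
have p := @even_partitionP a b m.+1 isT (ltW ab); have [pa pb _] := p.
have -> : mu * (g b - g a) =
    \sum_(k < m.+1) mu * (g (even_partition a b m.+1 k.+1) - g (even_partition a b m.+1 k)).
  rewrite -mulr_sumr -(big_mkord xpredT (fun k =>
    g (even_partition a b m.+1 k.+1) - g (even_partition a b m.+1 k))).
  by rewrite (telescope_sumr (g \o even_partition a b m.+1))//= pa pb.
rewrite /left_sum /stieltjes_sum mulr_sumr -big_split; apply: ler_sum => k _ /=.
have B i : (i <= m.+1)%N -> a <= even_partition a b m.+1 i <= b.
  exact: (tagged_partition_bounds p).
rewrite mulrA -mulrDl; apply: ler_wpM2r.
  rewrite subr_ge0; apply: gnd; last by have /andP[] := B _ (ltn_ord k).
    by have /andP[] := B _ (ltnW (ltn_ord k)).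
  exact: (tagged_partition_mono p).
apply: fh; have /andP[-> _] /= := B _ (ltnW (ltn_ord k)).
rewrite /even_partition -ltrBrDl gtr_pMr ?subr_gt0//.
by rewrite ltr_pdivrMr ?ltr0n// mul1r ltr_nat.
Unshelve. all: by end_near. Qed.

End StieltjesTheory.

Lemma stieltjes_ge0 (R : realType) (f g : R -> R) (a b : R) : a <= b ->
  (forall x, a <= x <= b -> 0 <= f x) -> nondecr_on g a b -> 0 <= stieltjes f g a b.
Proof.
(* If the integral does not exist, the default value 0 satisfies the claim. *)
move=> ab f0 gnd; rewrite /stieltjes; case: xgetP => [l _ fl|//].
have /cvg_lim <- // := left_sum_cvg ab fl; apply: limr_ge.
  by apply/cvg_ex; exists l; exact: left_sum_cvg.
near=> m; apply: sumr_ge0 => k _; have p := @even_partitionP _ a b m.+1 isT ab.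
have B i : (i <= m.+1)%N -> a <= even_partition a b m.+1 i <= b.
  exact: (tagged_partition_bounds p).
apply: mulr_ge0; first by apply: f0; exact/B/ltnW.
rewrite subr_ge0; apply: gnd.
- by have /andP[] := B k (ltnW (ltn_ord k)).
- exact: (tagged_partition_mono p).
- by have /andP[] := B k.+1 (ltn_ord k).
Unshelve. all: by end_near. Qed.

(** * Concave distortion functions *)

Section ConcaveDistortion.
Context {R : realType} (Q : R -> R) (Q_BUM : BUM Q) (Q_concave : concave_unit Q).

Lemma BUM_nondecr a b : 0 <= a -> b <= 1 -> nondecr_on Q a b.
Proof.
have [_ _ QM] := Q_BUM => a0 b1 x y ax; rewrite le_eqVlt => /predU1P[->//|xy] yb.
by apply: QM => //; [exact: le_trans ax|exact: le_trans b1].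
Qed.

Lemma BUM_ge0 x : 0 <= x <= 1 -> 0 <= Q x.
Proof.
have [Q0 _ _] := Q_BUM => /andP[x0 x1].
by rewrite -Q0; apply: (@BUM_nondecr 0 1).
Qed.

(** Concavity on the chord from 0 to [y], with [Q 0 = 0]: the slope [Q x / x] is nonincreasing, here
    cross-multiplied to allow [x = 0]. *)
Lemma concave_BUM_scale x y : 0 <= x -> x <= y -> y <= 1 -> x * Q y <= y * Q x.
Proof.
have [Q0 _ _] := Q_BUM => x0 xy y1.
have [y0|y0] := leP y 0; first by have -> : x = y by lra.
have := @Q_concave y 0 (x / y); rewrite Q0 !mulr0 !addr0 divfK ?gt_eqF//.
rewrite lexx ler01 (ltW y0) y1 divr_ge0 ?(ltW y0)// ler_pdivrMr// mul1r xy.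
by move=> /(_ isT isT isT); rewrite mulrAC ler_pdivrMr// [_ * y]mulrC.
Qed.

Lemma concave_BUM_ge x : 0 <= x <= 1 -> x <= Q x.
Proof.
have [_ Q1 _] := Q_BUM => /andP[x0 x1].
by have := concave_BUM_scale x0 x1 (lexx 1); rewrite Q1 mulr1 mul1r.
Qed.

(** Add the slope comparisons of [x] and of [y - x] with [y], then cancel [y]. *)
Lemma concave_BUM_subadd x y : 0 <= x -> x <= y -> y <= 1 -> Q y - Q x <= Q (y - x).
Proof.
have [Q0 _ _] := Q_BUM => x0 xy y1.
have [y0|y0] := leP y 0.
  by have [-> ->] : x = 0 /\ y = 0 by [split; lra]; rewrite !subrr Q0.
have h1 := concave_BUM_scale x0 xy y1.
have h2 : (y - x) * Q y <= y * Q (y - x) by apply: concave_BUM_scale => //; lra.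
rewrite -(ler_pM2l y0); lra.
Qed.

(** * Improper integrals against a concave distortion function *)

Section Improper.
Variable h : R -> \bar R.
Hypothesis h0 : h 0 = +oo%E.
Hypothesis h_ge0 : forall x, 0 < x <= 1 -> 0 <= fine (h x).
Hypothesis h_fin : (improper_stieltjes h Q < +oo)%E.

Let tail e := (stieltjes (fine \o h) Q e 1)%:E.

Let tail_ge0 e : 0 < e <= 1 -> (0 <= tail e)%E.
Proof.
move=> /andP[e0 e1]; rewrite lee_fin; apply: stieltjes_ge0 => //=.
  by move=> x /andP[ex x1]; apply: h_ge0; rewrite x1 (lt_le_trans e0).
by apply: BUM_nondecr => //; exact: ltW.
Qed.

Let lim_tail_ge0 : (0 <= lim (tail e @[e --> 0^'+]))%E.
Proof.
(* Without convergence, [lim] takes its default value 0. *)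
have [tc|tc] := pselect (cvg (tail e @[e --> 0^'+])); last by rewrite dvgP.
apply: lime_ge => //; near=> e; apply: tail_ge0; apply/andP; split; near: e.
  exact: nbhs_right_gt.
exact: nbhs_right_le.
Unshelve. all: by end_near. Qed.

Let Qimg := [set Q x | x in `]0, 1]].

Let Qimg_lb : has_lbound Qimg.
Proof.
exists 0 => _ [x + <-]; rewrite /= in_itv /= => /andP[x0 x1].
by apply: BUM_ge0; rewrite x1 ltW.
Qed.

Let lim_Q : lim (Q t @[t --> 0^'+]) = inf Qimg.
Proof.
apply/cvg_lim => //; apply: (@nondecreasing_at_right_cvgr R Q 0 (BRight 1)) => //.
  by rewrite bnd_simp.
move=> x y /=; rewrite !in_itv /= => /andP[x0 _] /andP[_ y1] xy.
by apply: (@BUM_nondecr 0 1) => //; exact: ltW.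
Qed.

(** A jump of [Q] at 0 would be multiplied by [h 0 = +oo], and the nonnegative limit of the tails
    could not compensate it, against [h_fin]. *)
Let inf_Qimg : inf Qimg = 0.
Proof.
have [Q0 Q1 _] := Q_BUM.
have : 0 <= inf Qimg.
  apply: lb_le_inf; first by exists (Q 1), 1 => //=; rewrite in_itv /= ltr01 lexx.
  move=> _ [x + <-]; rewrite /= in_itv /= => /andP[x0 x1].
  by apply: BUM_ge0; rewrite x1 ltW.
rewrite le_eqVlt => /predU1P[//|Ipos]; exfalso; move: h_fin.
rewrite /improper_stieltjes h0 lim_Q Q0 subr0 gt0_mulye ?lte_fin//.
by rewrite addye // -ltNye (lt_le_trans _ lim_tail_ge0).
Qed.

Lemma improper_stieltjes_BUM_small e : 0 < e ->
  exists2 d, 0 < d & forall x, 0 <= x <= 1 -> x < d -> Q x < e.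
Proof.
have [_ Q1 _] := Q_BUM.
move=> e0; have QI : has_inf Qimg.
  by split=> //; exists (Q 1), 1 => //=; rewrite in_itv /= ltr01 lexx.
have [_ [d + <-]] := inf_adherent e0 QI.
rewrite /= in_itv /= inf_Qimg add0r => /andP[d0 d1] Qd.
exists d => // x /andP[x0 x1] xd; apply: le_lt_trans Qd.
by apply: (@BUM_nondecr 0 1) => //; exact: ltW.
Qed.

(** Subadditivity, [Q y - Q x <= Q (y - x)], carries continuity at 0 over to the whole interval,
    uniformly. *)
Lemma improper_stieltjes_small_increments a b :
  0 <= a -> b <= 1 -> small_increments Q a b.
Proof.
move=> a0 b1 e e0; have [d d0 Qd] := improper_stieltjes_BUM_small e0.
exists d => // x y ax xy yb yxd; apply: le_lt_trans (Qd (y - x) _ yxd).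
  by apply: concave_BUM_subadd => //; [exact: le_trans ax|exact: le_trans b1].
by apply/andP; split; lra.
Qed.

Let improperE : improper_stieltjes h Q = lim (tail e @[e --> 0^'+]).
Proof.
by have [Q0 _ _] := Q_BUM; rewrite /improper_stieltjes lim_Q inf_Qimg Q0 subr0 mule0 add0e.
Qed.

Lemma improper_stieltjes_ge0 : (0 <= improper_stieltjes h Q)%E.
Proof. by rewrite improperE. Qed.

Hypothesis h_nonincr : forall x y, 0 < x -> x <= y -> y <= 1 -> fine (h y) <= fine (h x).

Lemma improper_is_stieltjes e : 0 < e <= 1 ->
  is_stieltjes (fine \o h) Q e 1 (stieltjes (fine \o h) Q e 1).
Proof.
move=> /andP[e0 e1].
have [l hl] : exists l, is_stieltjes (fine \o h) Q e 1 l.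
  apply: monotone_is_stieltjes => //.
  - by move=> x y ex xy y1; apply: h_nonincr => //; exact: lt_le_trans ex.
  - by apply: BUM_nondecr => //; exact: ltW.
  - by apply: improper_stieltjes_small_increments => //; exact: ltW.
by rewrite (stieltjesE e1 hl).
Qed.

(** Moving the cut from [y] down to [x] adds the nonnegative integral over [[x, y]]. *)
Let tail_nonincr : {in Interval (BRight 0) (BRight 1) &, nonincreasing_fun tail}.
Proof.
move=> x y; rewrite !in_itv /= => /andP[x0 x1] /andP[y0 y1] xy.
have [l hl] : exists l, is_stieltjes (fine \o h) Q x y l.
  apply: monotone_is_stieltjes => //.
  - move=> u v ux uv vy; apply: h_nonincr => //; first exact: lt_le_trans ux.
    exact: le_trans y1.
  - by apply: BUM_nondecr => //; exact: ltW.
  - by apply: improper_stieltjes_small_increments => //; exact: ltW.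
have hx : is_stieltjes (fine \o h) Q x 1 (stieltjes (fine \o h) Q x 1).
  by apply: improper_is_stieltjes; rewrite x0.
have hy : is_stieltjes (fine \o h) Q y 1 (stieltjes (fine \o h) Q y 1).
  by apply: improper_is_stieltjes; rewrite y0.
rewrite lee_fin (is_stieltjes_cat xy y1 hx hl hy) lerDr -(stieltjesE xy hl).
apply: stieltjes_ge0 => //.
  by move=> u /andP[xu uy]; apply: h_ge0; rewrite (lt_le_trans x0)//= (le_trans uy).
by apply: BUM_nondecr => //; exact: ltW.
Qed.

(** The tails grow as the cut decreases to 0, so their limit is their supremum. *)
Lemma stieltjes_le_improper e : 0 < e <= 1 ->
  ((stieltjes (fine \o h) Q e 1)%:E <= improper_stieltjes h Q)%E.
Proof.
move=> e01; rewrite improperE.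
have b01 : (BRight (0 : R) < BRight 1)%O by rewrite bnd_simp.
have /cvg_lim -> // := nonincreasing_at_right_cvge (BRight 1) b01 tail_nonincr.
by apply: ereal_sup_ubound; exists e => //=; rewrite in_itv.
Qed.

End Improper.
End ConcaveDistortion.

(** * Values at risk *)

(** Abel summation, which moves the differences from [q] to [v]. *)
Lemma sum_by_parts (R : comRingType) (v q : nat -> R) m : q 0%N = 0 ->
  \sum_(k < m.+1) v k * (q k.+1 - q k) =
  v m * q m.+1 + \sum_(k < m) (v k - v k.+1) * q k.+1.
Proof.
move=> q0; elim: m => [|m IH].
  by rewrite big_ord_recr !big_ord0 /= q0 add0r addr0 subr0.
by rewrite big_ord_recr /= IH [in RHS]big_ord_recr /=; ring.
Qed.

(** The right side is a staircase: the terms with [v k.+1 < y] telescope, and the total is the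
    smallest level not below [y], or [v m] if [y <= v m]. *)
Lemma le_sum_steps (R : realDomainType) (v : nat -> R) (y : R) m :
  (forall k, (k < m)%N -> v k.+1 <= v k) -> y <= v 0%N ->
  y <= v m + \sum_(k < m) (v k - v k.+1) * (v k.+1 < y)%R%:R.
Proof.
move=> vM yv; elim: m vM => [|m IH] vM; first by rewrite big_ord0 addr0.
have {}IH := IH (fun k km => vM k (ltnW km)).
rewrite big_ord_recr /=; have [vy|yv'] := ltP (v m.+1) y.
  by rewrite mulr1 [X in _ + X]addrC addrA subrKC.
rewrite mulr0 addr0 (le_trans yv')// lerDl; apply: sumr_ge0 => k _.
by rewrite mulr_ge0 ?ler0n// subr_ge0 vM// ltnS ltnW.
Qed.

Section Risk.
Context {R : realType} {d : measure_display} {T : measurableType d}.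
Context {P : probability T R} (Y : {RV P >-> R}).

Hypothesis Y_ge0 : forall y, y < 0 -> cdf Y y = 0%E.
Variable M : R.
Hypothesis Y_le : cdf Y M = 1%E.

Let level_lb t : 0 < t -> lbound [set y | (t%:E <= cdf Y y)%E] 0.
Proof.
move=> t0 y /= ty; rewrite leNgt; apply/negP => /Y_ge0 y0.
by move: ty; rewrite y0 lee_fin leNgt t0.
Qed.

Let support_lb : lbound [set y | (0 < cdf Y y)%E] 0.
Proof.
move=> y /= ty; rewrite leNgt; apply/negP => /Y_ge0 y0.
by rewrite y0 ltxx in ty.
Qed.

Let level_M t : t <= 1 -> (t%:E <= cdf Y M)%E.
Proof. by rewrite Y_le lee_fin. Qed.

Lemma VaR_ge0 t : t <= 1 -> 0 <= VaR Y t.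
Proof.
move=> t1; rewrite /VaR; case: ltP => t0; apply: lb_le_inf.
- by exists M; exact: level_M.
- exact: level_lb.
- by exists M; rewrite /= Y_le lte_fin.
- exact: support_lb.
Qed.

Lemma VaR_nondecr s t : 0 <= s -> s <= t -> t <= 1 -> VaR Y s <= VaR Y t.
Proof.
move=> s0 st t1; rewrite {2}/VaR; case: (ltP 0 t) => t0; last first.
  by rewrite /VaR ltNge (le_trans st).
apply: lb_le_inf; first by exists M; exact: level_M.
move=> y /= ty; rewrite /VaR; case: ltP => s0'; apply: ge_inf.
- by exists 0; exact: level_lb.
- by rewrite /= (le_trans _ ty)// lee_fin.
- by exists 0; exact: support_lb.
- by rewrite /= (lt_le_trans _ ty)// lte_fin.
Qed.

Lemma VaR_le t y : 0 < t -> (t%:E <= cdf Y y)%E -> VaR Y t <= y.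
Proof.
by move=> t0 ty; rewrite /VaR t0; apply: ge_inf => //; exists 0; exact: level_lb.
Qed.

(** Right continuity of the distribution function makes the infimum in [VaR] attained. *)
Lemma cdf_VaR t : 0 < t <= 1 -> (t%:E <= cdf Y (VaR Y t))%E.
Proof.
move=> /andP[t0 t1]; have := @cdf_right_continuous _ _ _ P Y (VaR Y t).
apply: cvge_ge; near=> x.
have VB : has_inf [set y | (t%:E <= cdf Y y)%E].
  by split; [exists M; exact: level_M|exists 0; exact: level_lb].
have Vx : 0 < x - VaR Y t by rewrite subr_gt0; near: x; exact: nbhs_right_gt.
have [y ty] := inf_adherent Vx VB.
rewrite -[inf _](_ : VaR Y t = _) ?subrKC; last by rewrite /VaR t0.
by move=> /ltW yx; rewrite (le_trans ty)// cdf_nondecreasing.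
Unshelve. all: by end_near. Qed.

Lemma tail_VaR t : 0 <= t < 1 -> (P [set w | VaR Y (1 - t) < Y w]%R <= t%:E)%E.
Proof.
move=> /andP[t0 t1]; have -> : [set w | VaR Y (1 - t) < Y w]%R = Y @^-1` `]VaR Y (1 - t), +oo[.
  by apply/seteqP; split => w /=; rewrite in_itv /= andbT.
rewrite -[X in (X <= _)%E]/(ccdf Y _) ccdf_1_cdf leeBlDr ?fin_num_measure//.
rewrite -leeBlDl// -EFinB; apply: cdf_VaR.
by apply/andP; split; lra.
Qed.

(** * Lower and upper bounds on the distortion risk *)

Section Distorted.
Variable Q : R -> R.
Hypothesis Q_BUM : BUM Q.
Hypothesis Q_concave : concave_unit Q.

(** Almost surely [Y] lies below the staircase with levels [v k]. Step [k] is climbed with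
    probability at most [q k.+1], hence at most [Q (q k.+1)], and summation by parts recognizes the
    resulting bound as the left sum. *)
Lemma expectation_le_left_sum m :
  ('E_P[Y] <= (left_sum (fun t => VaR Y (1 - t)) Q 0 1 m)%:E)%E.
Proof.
have [Q0 Q1 _] := Q_BUM.
pose q k : R := k%:R / m.+1%:R; pose v k := VaR Y (1 - q k).
have qB k : (k <= m.+1)%N -> 0 <= q k <= 1.
  by move=> km; rewrite divr_ge0//= ler_pdivrMr ?ltr0n// mul1r ler_nat.
have q_lt1 k : (k <= m)%N -> q k < 1.
  by move=> km; rewrite ltr_pdivrMr ?ltr0n// mul1r ltr_nat.
have qM k : q k <= q k.+1 by rewrite ler_pM2r ?invr_gt0 ?ltr0n// ler_nat.
have v_ge0 k : 0 <= v k by apply: VaR_ge0; rewrite gerBl divr_ge0.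
have vM k : (k < m)%N -> v k.+1 <= v k.
  move=> km; apply: VaR_nondecr; last by rewrite gerBl divr_ge0.
    by rewrite subr_ge0; have /andP[] := qB k.+1 (leqW km).
  by rewrite lerD2l lerN2.
have -> : left_sum (fun t => VaR Y (1 - t)) Q 0 1 m =
    v m + \sum_(k < m) (v k - v k.+1) * Q (q k.+1).
  have epE k : even_partition 0 1 m.+1 k = q k.
    by rewrite /even_partition subr0 mul1r add0r.
  rewrite /left_sum /stieltjes_sum; under eq_bigr do rewrite !epE.
  rewrite (@sum_by_parts _ v (fun k => Q (q k))) /q ?mul0r//.
  by rewrite divff ?Q1 ?mulr1// pnatr_eq0.
pose A k := [set w | v k.+1 < Y w].
have mA k : measurable (A k).
  rewrite [A k](_ : _ = Y @^-1` `]v k.+1, +oo[); first exact: measurable_funPTI.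
  by apply/seteqP; split => w /=; rewrite in_itv /= andbT.
pose stepf (k : 'I_m) : T -> \bar R := fun w => ((v k - v k.+1)%:E * (\1_(A k) w)%:E)%E.
pose step w := ((v m)%:E + \sum_(k < m) stepf k w)%E.
have step_ge0 (k : 'I_m) w : (0 <= stepf k w)%E.
  by rewrite mule_ge0// lee_fin ?subr_ge0 ?vM.
have step_meas (k : 'I_m) : measurable_fun [set: T] (stepf k).
  apply: measurable_funeM; exact/measurable_EFinP/measurable_indic.
have sum_step_meas : measurable_fun [set: T] (fun w => \sum_(k < m) stepf k w)%E.
  exact: emeasurable_sum.
have int_step : (\int[P]_w step w <= (v m + \sum_(k < m) (v k - v k.+1) * Q (q k.+1))%:E)%E.
  rewrite ge0_integralD//=; last 2 first.
  - by move=> w _; rewrite lee_fin.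
  - by move=> w _; apply: sume_ge0.
  rewrite integral_cst//= probability_setT mule1 EFinD leeD2l//.
  rewrite ge0_integral_sum//= -sumEFin; apply: lee_sum => k _.
  rewrite ge0_integralZl_EFin//; last 2 first.
  - exact/measurable_EFinP/measurable_indic.
  - by rewrite subr_ge0 vM.
  rewrite integral_indic// setIT EFinM.
  apply: lee_wpmul2l; first by rewrite lee_fin subr_ge0 vM.
  (* Here concavity enters, through [t <= Q t]. *)
  apply: (@le_trans _ _ (q k.+1)%:E); last first.
    by rewrite lee_fin; apply: concave_BUM_ge => //; exact/qB/leqW.
  by apply: tail_VaR; rewrite q_lt1// andbT; have /andP[] := qB k.+1 (leqW (ltn_ord k)).
(* Discarding the negative part of [Y] leaves a nonnegative integrand, so integrability of [Y] is
   not presupposed. *)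
apply: le_trans int_step; rewrite unlock integralE.
apply: (@le_trans _ _ (\int[P]_w ((fun w => (Y w)%:E) ^\+ w))%E).
  by rewrite -[leRHS]adde0 leeD2l// oppe_le0 integral_ge0.
apply: ae_ge0_le_integral => //.
- apply: measurable_funepos; exact/measurable_EFinP.
- by move=> w _; rewrite adde_ge0 ?lee_fin// sume_ge0.
- by apply: emeasurable_funD.
(* The staircase dominates [Y] up to its top level, the value at risk at level 1, which [Y] exceeds
   with probability 0. *)
exists [set w | v 0%N < Y w]; split.
- rewrite [X in measurable X](_ : _ = Y @^-1` `]v 0%N, +oo[); first exact: measurable_funPTI.
  by apply/seteqP; split => w /=; rewrite in_itv /= andbT.
- apply/eqP; rewrite eq_le measure_ge0 andbT.
  have -> : v 0%N = VaR Y (1 - 0) by rewrite /v /q mul0r.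
  by apply: tail_VaR; rewrite lexx ltr01.
move=> w /= Yw; rewrite ltNge; apply: contra_notN Yw => Yv _.
have -> : step w = (v m + \sum_(k < m) (v k - v k.+1) * (v k.+1 < Y w)%R%:R)%:E.
  rewrite /step EFinD -sumEFin; congr (_ + _)%E; apply: eq_bigr => k _.
  rewrite /stepf -EFinM indicE; congr (_ * _%:R)%:E; congr nat_of_bool.
  by apply/idP/idP; rewrite inE.
rewrite funeposE -EFin_max lee_fin ge_max le_sum_steps//= addr_ge0//.
by rewrite sumr_ge0// => k _; rewrite mulr_ge0 ?ler0n// subr_ge0 vM.
Qed.

Lemma VaR_is_stieltjes a b : 0 <= a -> a <= b -> b <= 1 -> small_increments Q 0 1 ->
  exists l, is_stieltjes (fun t => VaR Y (1 - t)) Q a b l.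
Proof.
move=> a0 ab b1 Qs; apply: monotone_is_stieltjes => //.
- by move=> x y ax xy yb; apply: VaR_nondecr; lra.
- by apply: BUM_nondecr.
move=> e e0; have [dl dl0 Qd] := Qs e e0; exists dl => // x y ax xy yb.
by apply: Qd => //; [exact: le_trans ax|exact: le_trans b1].
Qed.

Lemma expectation_le_distortion_risk : small_increments Q 0 1 ->
  ('E_P[Y] <= (distortion_risk Q Y)%:E)%E.
Proof.
move=> Qs; have [l fl] := VaR_is_stieltjes (lexx 0) ler01 (lexx 1) Qs.
rewrite /distortion_risk (stieltjesE ler01 fl).
(* The mean is an extended real; the bound by a single left sum excludes [+oo]. *)
have EY m := expectation_le_left_sum m; case: ('E_P[Y])%E EY => [r| |] EY.
- rewrite lee_fin; apply: (cvgr_to_ge (left_sum_cvg ler01 fl)); near=> m.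
  by have := EY m; rewrite lee_fin.
- by have := EY 0%N.
- exact: leNye.
Unshelve. all: by end_near. Qed.

(** Since [h] is infinite at 0, the integral is cut at a small [e]. On [[0, e]] the value at risk is
    at most [V 0] and [Q e] is small; on [[e, 1]] the pointwise bound is integrated, and the tail of
    [h] is at most the improper integral. *)
Lemma distortion_risk_le (h : R -> \bar R) (mu c : R) :
  h 0 = +oo%E -> (forall x, 0 < x <= 1 -> 0 <= fine (h x)) ->
  (forall x y, 0 < x -> x <= y -> y <= 1 -> fine (h y) <= fine (h x)) ->
  (improper_stieltjes h Q < +oo)%E -> 0 <= c ->
  (forall t, 0 < t < 1 -> VaR Y (1 - t) <= mu + c * fine (h t)) ->
  distortion_risk Q Y <= mu + c * fine (improper_stieltjes h Q).
Proof.
move=> h0 h_ge0 h_ni h_fin c0 Vle; have [Q0 Q1 _] := Q_BUM.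
have Qs : small_increments Q 0 1.
  exact: (improper_stieltjes_small_increments Q_BUM Q_concave h0 h_ge0 h_fin).
have J_ge0 := improper_stieltjes_ge0 Q_BUM h0 h_ge0 h_fin.
set J := improper_stieltjes h Q in h_fin J_ge0 *.
have JE : J = (fine J)%:E by rewrite fineK// ge0_fin_numE.
pose V t := VaR Y (1 - t).
have V_le0 t : 0 <= t <= 1 -> V t <= V 0 by move=> t01; apply: VaR_nondecr; lra.
have [l fl] := VaR_is_stieltjes (lexx 0) ler01 (lexx 1) Qs.
rewrite /distortion_risk (stieltjesE ler01 fl).
apply/ler_addgt0Pr => eps eps0.
have D0 : 0 < `|V 0 - mu| + 1 by rewrite ltr_wpDl.
have [dl dl0 Qd] := improper_stieltjes_BUM_small Q_BUM h0 h_ge0 h_fin (divr_gt0 eps0 D0).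
(* The cut has to lie below [dl], to make [Q e] small, and below 1. *)
pose e := Num.min (dl / 2) 2^-1.
have e0 : 0 < e by rewrite lt_min; apply/andP; split; lra.
have e1 : e < 1 by rewrite gt_min; apply/orP; right; lra.
have edl : e < dl by rewrite gt_min; apply/orP; left; lra.
have [l1 fl1] := VaR_is_stieltjes (lexx 0) (ltW e0) (ltW e1) Qs.
have [l2 fl2] := VaR_is_stieltjes (ltW e0) (ltW e1) (lexx 1) Qs.
rewrite (is_stieltjes_cat (ltW e0) (ltW e1) fl fl1 fl2).
have Qe0 : 0 <= Q e by apply: BUM_ge0 => //; rewrite !ltW.
have Qeps : Q e < eps / (`|V 0 - mu| + 1) by apply: Qd => //; rewrite !ltW.
(* A constant bound is the affine comparison with coefficient 0; the comparison function is then
   arbitrary. *)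
have l1_le : l1 <= V 0 * (Q e - Q 0) + 0 * l1.
  apply: (is_stieltjes_le_affine e0 fl1 fl1).
    by apply: BUM_nondecr => //; exact: ltW.
  by move=> x /andP[x0 xe]; rewrite mul0r addr0; apply: V_le0; lra.
have hl2 : is_stieltjes (fine \o h) Q e 1 (stieltjes (fine \o h) Q e 1).
  by apply: improper_is_stieltjes => //; rewrite e0 ltW.
have l2_le : l2 <= mu * (Q 1 - Q e) + c * stieltjes (fine \o h) Q e 1.
  apply: (is_stieltjes_le_affine e1 fl2 hl2).
    by apply: BUM_nondecr => //; exact: ltW.
  by move=> x /andP[ex x1]; apply: Vle; rewrite (lt_le_trans e0).
have cJ : c * stieltjes (fine \o h) Q e 1 <= c * fine J.
  rewrite ler_wpM2l// -lee_fin -JE.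
  by apply: stieltjes_le_improper => //; rewrite e0 ltW.
(* The two pieces contribute [V 0 * Q e] and [mu * (1 - Q e)], which exceed [mu] by this
   quantity. *)
have VQ : (V 0 - mu) * Q e <= eps.
  have h1 : (V 0 - mu) * Q e <= `|V 0 - mu| * Q e by rewrite ler_wpM2r// ler_norm.
  have h2 : `|V 0 - mu| * Q e <= (`|V 0 - mu| + 1) * Q e by rewrite ler_wpM2r// lerDl.
  have h3 : (`|V 0 - mu| + 1) * Q e < eps by rewrite mulrC -ltr_pdivlMr.
  exact/ltW/(le_lt_trans h1)/(le_lt_trans h2).
rewrite Q0 in l1_le; rewrite Q1 in l2_le; lra.
Qed.

End Distorted.
End Risk.

(** * Independent uniform random variables *)

Section Independence.
Context {R : realType} {d : measure_display} {T : measurableType d}.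
Context {P : probability T R}.
Import HBNNSimple.

Lemma integral_indic_RV (X : {RV P >-> R}) B : measurable B ->
  (\int[P]_w (\1_B (X w))%:E)%E = P (X @^-1` B).
Proof.
move=> mB; have mXB : measurable (X @^-1` B) by exact: measurable_funPTI.
by have := @integral_indic _ _ _ P [set: T] measurableT _ mXB; rewrite setIT.
Qed.

(** The identity passes from indicators to simple functions by linearity, and to nonnegative
    measurable functions by monotone convergence. *)
Lemma ge0_integral_mul_indep (X : {RV P >-> R}) (h : T -> R) (K : \bar R) :
  measurable_fun [set: T] h -> (forall w, 0 <= h w) -> K \is a fin_num ->
  (forall B, measurable B ->
    \int[P]_w (h w * \1_B (X w))%:E = K * \int[P]_w (\1_B (X w))%:E)%E ->
  forall g : R -> R, measurable_fun [set: R] g -> (forall x, 0 <= g x) ->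
    (\int[P]_w (h w * g (X w))%:E = K * \int[P]_w (g (X w))%:E)%E.
Proof.
move=> mh h0 Kfin hB g mg g0.
have mf : measurable_fun [set: R] (EFin \o g) by exact/measurable_EFinP.
pose f := nnsfun_approx measurableT mf.
have mX : measurable_fun [set: T] X by [].
have f_cvg x : (f n x)%:E @[n --> \oo] --> (g x)%:E.
  by apply: cvg_nnsfun_approx => // y _; rewrite lee_fin.
have f_nd x m n : (m <= n)%N -> f m x <= f n x.
  by move=> mn; exact/lefP/nd_nnsfun_approx.
have mfX n : measurable_fun [set: T] (f n \o X).
  exact: measurableT_comp.
have lhs_cvg : (\int[P]_w (h w * f n (X w))%:E)%E @[n --> \oo] -->
    (\int[P]_w (h w * g (X w))%:E)%E.
  rewrite (_ : \int[P]_w (h w * g (X w))%:E =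
      \int[P]_w limn (fun n => (h w * f n (X w))%:E))%E; last first.
    apply: eq_integral => w _; apply/esym/cvg_lim => //.
    under eq_fun do rewrite EFinM; rewrite EFinM.
    by apply: cvgeZl => //; exact: f_cvg.
  apply: cvg_monotone_convergence => //.
  - by move=> n; apply/measurable_EFinP; apply: measurable_funM => //; exact: mfX.
  - by move=> n w _; rewrite lee_fin mulr_ge0.
  - by move=> w _ m n mn; rewrite lee_fin ler_wpM2l// f_nd.
have rhs_cvg : (K * \int[P]_w (f n (X w))%:E)%E @[n --> \oo] -->
    (K * \int[P]_w (g (X w))%:E)%E.
  apply: cvgeZl => //.
  rewrite (_ : \int[P]_w (g (X w))%:E = \int[P]_w limn (fun n => (f n (X w))%:E))%E; last first.
    by apply: eq_integral => w _; apply/esym/cvg_lim => //; exact: f_cvg.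
  apply: cvg_monotone_convergence => //.
  - by move=> n; apply/measurable_EFinP; exact: mfX.
  - by move=> n w _; rewrite lee_fin.
  - by move=> w _ m n mn; rewrite lee_fin f_nd.
rewrite -(cvg_lim _ lhs_cvg)// -(cvg_lim _ rhs_cvg)//.
apply: congr_lim; apply/funext => n; move: (f n) => {mf f f_cvg f_nd mfX lhs_cvg rhs_cvg} f.
have mA y : measurable (f @^-1` [set y]) by exact: measurable_funPTI.
have m1 y : measurable_fun [set: T] (fun w => \1_(f @^-1` [set y]) (X w) : R).
  by apply: measurableT_comp => //; exact: measurable_indic.
(* Where the indicator is nonzero, [y] is a value of [f], hence nonnegative; writing [|y|] makes all
   coefficients visibly nonnegative. *)
have [s fE] : exists s : seq R, forall x,
    f x = \sum_(y <- s) `|y| * \1_(f @^-1` [set y]) x.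
  eexists => x; rewrite {1}fimfunE fsbig_finite//; apply: eq_bigr => y _; rewrite indicE.
  case: (boolP (x \in f @^-1` [set y])) => [|_]; last by rewrite !mulr0.
  by rewrite inE => /= <-; rewrite ger0_norm.
have intE (k : T -> R) : (forall w, 0 <= k w) -> measurable_fun [set: T] k ->
    (\int[P]_w (k w * f (X w))%:E =
     \sum_(y <- s) `|y|%:E * \int[P]_w (k w * \1_(f @^-1` [set y]) (X w))%:E)%E.
  move=> k0 mk.
  have mk1 y : measurable_fun [set: T] (fun w => (k w * \1_(f @^-1` [set y]) (X w))%:E).
    by apply/measurable_EFinP; exact: measurable_funM.
  under eq_integral.
    move=> w _; rewrite fE mulr_sumr -sumEFin.
    under eq_bigr do rewrite mulrCA EFinM.
    over.
  rewrite ge0_integral_sum//.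
  - apply: eq_bigr => y _; rewrite ge0_integralZl_EFin// => w _.
    by rewrite lee_fin mulr_ge0.
  - by move=> y; exact: measurable_funeM.
  - by move=> y w _; rewrite mule_ge0// lee_fin ?mulr_ge0.
rewrite (intE h)//.
rewrite (_ : \int[P]_w (f (X w))%:E = \int[P]_w (1 * f (X w))%:E)%E; last first.
  by apply: eq_integral => w _; rewrite mul1r.
rewrite (intE (fun=> 1))//.
rewrite ge0_sume_distrr; last first.
  by move=> y _; rewrite mule_ge0// integral_ge0// => w _; rewrite mul1r lee_fin.
apply: eq_bigr => y _; rewrite hB// muleCA; congr (_ * (_ * _))%E.
by apply: eq_integral => w _; rewrite mul1r.
Qed.

Lemma ge0_integral_prod_indep n (C : 'I_n -> {RV P >-> R}) (g : 'I_n -> R -> R) :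
  independent_RVs C ->
  (forall i, measurable_fun [set: R] (g i)) -> (forall i x, 0 <= g i x) ->
  (forall i, (\int[P]_w (g i (C i w))%:E)%E \is a fin_num) ->
  (\int[P]_w (\prod_(i < n) g i (C i w))%:E = \prod_(i < n) \int[P]_w (g i (C i w))%:E)%E.
Proof.
move=> indep mg g0 gfin.
(* The indicators of the product rule are replaced by the [g i] one at a time. *)
suff H k : forall F : 'I_n -> R -> R,
    (forall i, measurable_fun [set: R] (F i)) -> (forall i x, 0 <= F i x) ->
    (forall i, (\int[P]_w (F i (C i w))%:E)%E \is a fin_num) ->
    (forall i : 'I_n, (k <= i)%N -> exists2 B, measurable B & F i = \1_B) ->
    (\int[P]_w (\prod_(i < n) F i (C i w))%:E = \prod_(i < n) \int[P]_w (F i (C i w))%:E)%E.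
  by apply: (H n) => // i; rewrite leqNgt ltn_ord.
elim: k => [|k IH] F mF F0 Ffin FB.
  (* With indicators only, the product is the indicator of an intersection and the claim is the
     product rule for all indices. *)
  have [B BP] : {B : 'I_n -> set R & forall i, measurable (B i) /\ F i = \1_(B i)}.
    apply: (@choice _ _ (fun i B => measurable B /\ F i = \1_B)) => i.
    by have [B] := FB i isT; exists B.
  have := indep [set: 'I_n]%SET B (fun i => (BP i).1).
  set A := (X in P X) => PA.
  have mA : measurable A.
    apply: fin_bigcap_measurable => // i _; apply: measurable_funPTI.
    exact: (BP i).1.
  have -> : (\int[P]_w (\prod_(i < n) F i (C i w))%:E = \int[P]_w (\1_A w)%:E)%E.
    apply: eq_integral => w _; congr EFin; rewrite indicE.
    have [/set_mem wA|/negP wA] := boolP (w \in A).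
      apply: big1 => i _; rewrite (BP i).2 indicE mem_set//.
      by apply: wA; rewrite /= inE.
    have [i wi] : exists i, ~ B i (C i w).
      apply/existsNP => wB; apply: wA; rewrite inE => i _; exact: wB.
    by rewrite (bigD1 i)//= (BP i).2 indicE memNset// mul0r.
  rewrite (@integral_indic _ _ _ P [set: T] measurableT _ mA) (setIT A).
  rewrite [LHS]PA; apply: eq_big => [i|i _]; first by rewrite inE.
  by rewrite (BP i).2 integral_indic_RV//; exact: (BP i).1.
have [kn|kn] := leqP n k.
  by apply: IH => // i ki; have := leq_ltn_trans kn (leq_ltn_trans ki (ltn_ord i)); rewrite ltnn.
pose j := Ordinal kn.
rewrite (bigD1 j)//=.
under eq_integral do rewrite (bigD1 j)//= mulrC.
rewrite muleC.
apply: (@ge0_integral_mul_indep (C j) (fun w => \prod_(i < n | i != j) F i (C i w))) => //.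
- under eq_fun do rewrite -big_filter.
  by apply: measurable_prod => i _; exact: measurableT_comp.
- by move=> w; apply: prodr_ge0.
- by apply: prode_fin_num.
move=> B mB.
(* With its factor [j] turned into an indicator, the family falls under the induction hypothesis. *)
pose F' i := if i == j then \1_B else F i.
have F'j : F' j = \1_B by rewrite /F' eqxx.
have F'i i : i != j -> F' i = F i by rewrite /F' => /negbTE ->.
have int1 : (\int[P]_w (\1_B (C j w))%:E)%E \is a fin_num.
  by rewrite integral_indic_RV// fin_num_measure//; exact: measurable_funPTI.
have IHF' : (\int[P]_w (\prod_(i < n) F' i (C i w))%:E =
    \prod_(i < n) \int[P]_w (F' i (C i w))%:E)%E.
  apply: IH => i; have [ij|ij] := eqVneq i j; rewrite ?ij ?F'j ?F'i//.
  - by exists B.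
  - rewrite leq_eqVlt => /predU1P[ki|]; last exact: FB.
    by move/eqP : ij; case; apply: val_inj; rewrite /= ki.
transitivity (\int[P]_w (\prod_(i < n) F' i (C i w))%:E)%E.
  apply: eq_integral => w _; congr EFin; rewrite [RHS](bigD1 j)//= F'j mulrC.
  by congr (_ * _); apply: eq_bigr => i ij; rewrite F'i.
rewrite IHF' (bigD1 j)//= F'j muleC; congr (_ * _)%E.
by apply: eq_bigr => i ij; rewrite F'i.
Qed.

End Independence.

(** * An exponential bound for the hyperbolic sine *)

(** From [k] to [k + 1] the left side gains the factor [6 (k + 1)] and the right side
    [(2k + 2) (2k + 3)]. *)
Lemma fact_doubleS_ge k : (6 ^ k * k`! <= (k.*2.+1)`!)%N.
Proof.
elim: k => [//|k IH]; rewrite doubleS !factS expnS.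
rewrite (_ : 6 * 6 ^ k * (k.+1 * k`!) = (6 * k.+1) * (6 ^ k * k`!))%N; last by ring.
rewrite [leqRHS]mulnA; apply: leq_mul => //; rewrite -mul2n; nia.
Qed.

(* Termwise comparison of [sinh u / u = \sum u^2k / (2k+1)!] with [\sum u^2k / (6^k k!)]. *)
Lemma expR_sub_le (R : realType) (u : R) : 0 <= u ->
  expR u - expR (- u) <= 2 * u * expR (u ^+ 2 / 6).
Proof.
move=> u0.
have cvg_exp (x : R) : series (exp_coeff x) n @[n --> \oo] --> expR x.
  exact: is_cvg_series_exp_coeff.
have cvg_dbl (x : R) : series (exp_coeff x) n.*2 @[n --> \oo] --> expR x.
  apply: (cvg_comp _ _ _ (cvg_exp x)); apply/cvgnyPge => A; near=> n.
  rewrite (@leq_trans n)// -?addnn ?leq_addr//; near: n; exact: nbhs_infty_ge.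
have lhs : (series (exp_coeff u) n.*2 - series (exp_coeff (- u)) n.*2) @[n --> \oo] -->
    expR u - expR (- u) by apply: cvgB; exact: cvg_dbl.
have rhs : 2 * u * series (exp_coeff (u ^+ 2 / 6)) n @[n --> \oo] --> 2 * u * expR (u ^+ 2 / 6).
  by apply: cvgMr; exact: cvg_exp.
(* Up to an even number of terms, the even powers cancel and the odd ones double. *)
have oddE n : series (exp_coeff u) n.*2 - series (exp_coeff (- u)) n.*2 =
    \sum_(0 <= k < n) 2 * u * (u ^+ 2) ^+ k / (k.*2.+1)`!%:R.
  elim: n => [|n IH]; first by rewrite /series /= !big_nil subrr.
  rewrite doubleS big_nat_recr//= -IH /series /= !big_nat_recr//= /exp_coeff /=.
  have sq (x : R) : x ^+ n.*2 = (x ^+ 2) ^+ n by rewrite -mul2n exprM.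
  rewrite !(exprS _ n.*2) !sq sqrrN; move: ((u ^+ 2) ^+ n) => v.
  by field; rewrite !pnatr_eq0 -!lt0n !fact_gt0.
apply: (ler_cvg_to lhs rhs); near=> n; rewrite oddE.
rewrite /series /= mulr_sumr; apply: ler_sum_nat => k _; rewrite /exp_coeff /=.
rewrite expr_div_n -!mulrA !ler_wpM2l// ?exprn_ge0 ?sqr_ge0//.
rewrite -invfM lef_pV2 ?posrE ?mulr_gt0 ?exprn_gt0 ?ltr0n ?fact_gt0//.
by rewrite -natrX -natrM ler_nat fact_doubleS_ge.
Unshelve. all: by end_near. Qed.

(** * Moments of uniform laws *)

Lemma integral_itv_is_derive (R : realType) (f F : R -> R) (a b : R) : a < b ->
  (forall x, is_derive x (1 : R) F (f x)) -> continuous f ->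
  (\int[lebesgue_measure]_(x in `[a, b]) (f x)%:E = (F b - F a)%:E)%E.
Proof.
move=> ab dF cf; rewrite EFinB; apply: continuous_FTC2 => //.
- exact: continuous_subspaceT.
- have cF : continuous F.
    move=> x; apply: differentiable_continuous; apply/derivable1_diffP.
    exact: @ex_derive _ _ _ _ _ _ _ (dF x).
  split=> [x _||].
  + exact: @ex_derive _ _ _ _ _ _ _ (dF x).
  + by apply: cvg_at_right_filter; exact: cF.
  + by apply: cvg_at_left_filter; exact: cF.
- by move=> x _; rewrite derive1E; exact: @derive_val _ _ _ _ _ _ _ (dF x).
Qed.

Section Uniform.
Context {R : realType} {d : measure_display} {T : measurableType d}.
Context {P : probability T R} (X : {RV P >-> R}) (a b : R).
Local Notation mu := (@lebesgue_measure R).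

Lemma ge0_integral_uniform_RV (f : R -> R) : uniform_RV X a b -> a < b ->
  measurable_fun [set: R] f -> (forall x, 0 <= f x) ->
  (\int[P]_w (f (X w))%:E = (b - a)^-1%:E * \int[mu]_(x in `[a, b]) (f x)%:E)%E.
Proof.
move=> [_ XU _] ab mf f0.
have mf' : measurable_fun [set: R] (EFin \o f) by exact/measurable_EFinP.
have f0' x : (0 <= (EFin \o f) x)%E by rewrite lee_fin.
rewrite -(integral_uniform ab mf' f0').
rewrite -[LHS](ge0_integral_distribution X mf' f0').
(* [distribution P X] and [uniform_prob ab] live on two copies of [R] with different displays. *)
pose idR : measurableTypeR R -> R := idfun.
have mid : measurable_fun [set: measurableTypeR R] idR by exact: measurable_id.
pose idm : {mfun measurableTypeR R >-> R} := HB.pack idR (isMeasurableFun.Build _ _ _ _ _ mid).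
transitivity (\int[pushforward (uniform_prob ab) idm]_y (f y)%:E)%E.
  by apply: eq_measure_integral => A mA _; exact: XU.
exact: (ge0_integral_pushforward mid _ _ mf' (in1W f0')).
Qed.

Lemma integral_uniform_RV_degenerate (f : R -> R) : uniform_RV X a a ->
  measurable_fun [set: R] f -> (forall x, 0 <= f x) ->
  (\int[P]_w (f (X w))%:E = (f a)%:E)%E.
Proof.
move=> [_ _ XD] mf f0.
have mf' : measurable_fun [set: R] (EFin \o f) by exact/measurable_EFinP.
have f0' x : (0 <= (EFin \o f) x)%E by rewrite lee_fin.
rewrite -[LHS](ge0_integral_distribution X mf' f0').
transitivity (\int[\d_a]_y (f y)%:E)%E.
  by apply: eq_measure_integral => A mA _; exact: XD.
by rewrite integral_dirac// diracT mul1e.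
Qed.

Lemma uniform_RV_itv : uniform_RV X a b -> P (X @^-1` `[a, b]) = 1%E.
Proof.
move=> XU; have [ab XU1 XU0] := XU; rewrite -[LHS]/(distribution P X _).
move: ab; rewrite le_eqVlt => /predU1P[ab|ab].
  by rewrite XU0// diracE mem_set//= ab in_itv /= lexx.
by rewrite XU1//; exact: integral_uniform_pdf1.
Qed.

Lemma uniform_RV_setC_itv : uniform_RV X a b -> P (~` (X @^-1` `[a, b])) = 0%E.
Proof.
move=> XU; have mXab : measurable (X @^-1` `[a, b]) by exact: measurable_funPTI.
have PC : (P (~` (X @^-1` `[a, b])) = 1 - P (X @^-1` `[a, b]))%E.
  exact: probability_setC.
by rewrite PC uniform_RV_itv// subee.
Qed.

(** For [u = l (b - a) / 2] the left side is [exp (l (a + b) / 2) * sinh u / u], and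
    [sinh u / u <= exp (u^2 / 6)]. The cases [l = 0] and [a = b], where [u = 0], are treated
    apart. *)
Lemma uniform_RV_mgf_le l : uniform_RV X a b -> 0 <= l ->
  (\int[P]_w (expR (l * X w))%:E <=
   (expR (l * ((a + b) / 2) + l ^+ 2 * (b - a) ^+ 2 / 24))%:E)%E.
Proof.
move=> XU; have [ab _ _] := XU.
have me : measurable_fun [set: R] (fun x => expR (l * x)).
  by apply: measurableT_comp => //; exact: mulrl_measurable.
rewrite le_eqVlt => /predU1P[<-|l0].
  under eq_integral do rewrite mul0r expR0.
  by rewrite expr0n /= !mul0r addr0 expR0 integral_cst//= probability_setT mule1.
move: ab; rewrite le_eqVlt => /predU1P[ab|ab].
  rewrite -ab in XU *; rewrite (integral_uniform_RV_degenerate XU me) ?lee_fin//.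
  by rewrite subrr expr0n /= mulr0 mul0r addr0 ler_expR; lra.
rewrite (ge0_integral_uniform_RV XU ab me); last by move=> x; exact: expR_ge0.
have dF (x : R) : is_derive x (1 : R) (fun y => l^-1 * expR (l * y)) (expR (l * x)).
  have dl : is_derive x (1 : R) (fun y => l * y) l.
    by apply: is_derive_eq; rewrite -[RHS]mulr1.
  have de := @is_derive1_comp _ expR _ x _ _ (is_derive_expR (l * x)) dl.
  apply: (is_derive_eq (is_deriveZ l^-1 de)).
  by rewrite -[LHS]/(l^-1 * _) mulrCA mulVf ?mulr1// gt_eqF.
rewrite (integral_itv_is_derive ab dF); last first.
  move=> x; apply: continuous_comp; last exact: continuous_expR.
  exact: mulrl_continuous.
rewrite -EFinM lee_fin.
set u := l * (b - a) / 2.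
have u0 : 0 < u by rewrite divr_gt0// mulr_gt0// subr_gt0.
have -> : l * b = l * ((a + b) / 2) + u by rewrite /u; field.
have -> : l * a = l * ((a + b) / 2) - u by rewrite /u; field.
have -> : l ^+ 2 * (b - a) ^+ 2 / 24 = u ^+ 2 / 6 by rewrite /u; field.
have lba : 0 < l * (b - a) by rewrite mulr_gt0// subr_gt0.
have uE : 2 * u = l * (b - a) by rewrite /u; field.
have := expR_sub_le (ltW u0); rewrite uE -ler_pdivrMl//.
move: (l * ((a + b) / 2)) (u) (u ^+ 2 / 6) => m v w vw.
rewrite !expRD [leLHS](_ : _ = expR m * ((l * (b - a))^-1 * (expR v - expR (- v)))).
  by rewrite ler_pM2l ?expR_gt0.
by field; rewrite !gt_eqF// subr_gt0.
Qed.

(** The absolute value gives a nonnegative integrand, so one computation yields integrability and,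
    as [X] is almost surely nonnegative, the mean. *)
Lemma integral_normr_uniform_RV : uniform_RV X a b -> 0 <= a ->
  (\int[P]_w `|X w|%:E = ((a + b) / 2)%:E)%E.
Proof.
move=> XU a0; have [ab _ _] := XU.
have mn : measurable_fun [set: R] (fun x : R => `|x|) by exact: normr_measurable.
move: ab; rewrite le_eqVlt => /predU1P[ab|ab].
  rewrite -ab in XU *; rewrite (integral_uniform_RV_degenerate XU mn)//.
  by rewrite ger0_norm//; congr EFin; field.
rewrite (ge0_integral_uniform_RV XU ab mn)//.
under eq_integral.
  move=> x; rewrite inE /= in_itv /= => /andP[ax _].
  rewrite ger0_norm ?(le_trans a0)//; over.
have dF (x : R) : is_derive x (1 : R) (fun y => 2^-1 * y ^+ 2) x.
  by apply: is_derive_eq; rewrite -[LHS]/(2^-1 * _) /GRing.scale /=; field.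
rewrite (integral_itv_is_derive ab dF); last by move=> x; exact: cvg_id.
by rewrite -EFinM; congr EFin; field; rewrite subr_eq0 gt_eqF.
Qed.

Lemma uniform_RV_Lfun1 : uniform_RV X a b -> 0 <= a -> (X : T -> R) \in Lfun P 1.
Proof.
move=> XU a0; apply/Lfun1_integrable/integrableP; split; first exact/measurable_EFinP.
by rewrite (integral_normr_uniform_RV XU a0) ltry.
Qed.

Lemma uniform_RV_expectation : uniform_RV X a b -> 0 <= a ->
  ('E_P[X] = ((a + b) / 2)%:E)%E.
Proof.
move=> XU a0; rewrite -(integral_normr_uniform_RV XU a0) unlock.
have mXab : measurable (X @^-1` `[a, b]) by exact: measurable_funPTI.
apply: ae_eq_integral => //; [exact/measurable_EFinP| |].
  by apply/measurable_EFinP; exact: measurableT_comp.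
exists (~` (X @^-1` `[a, b])); split.
- exact: measurableC.
- exact: uniform_RV_setC_itv.
move=> w /=; apply: contra_not => /[!in_itv]/= /andP[aX _] _.
by rewrite ger0_norm// (le_trans a0).
Qed.

End Uniform.

(** * Bounds on the risk of the total cost *)

Section LogIntegrands.
Context {R : realType}.
Implicit Types t : R.

Lemma fine_ln_inv t : 0 < t -> fine (ln_inv t) = ln t^-1.
Proof. by move=> t0; rewrite /ln_inv gt_eqF. Qed.

Lemma fine_sqrt_ln_inv t : 0 < t -> fine (sqrte (ln_inv t)) = Num.sqrt (ln t^-1).
Proof. by move=> t0; rewrite /ln_inv gt_eqF. Qed.

Lemma ln_inv0 : ln_inv (0 : R) = +oo%E.
Proof. by rewrite /ln_inv eqxx. Qed.

Lemma ln_invr_ge0 t : 0 < t <= 1 -> 0 <= ln t^-1.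
Proof. by move=> /andP[t0 t1]; rewrite ln_ge0// invf_ge1. Qed.

Lemma ltey_pmul (c : R) (y : \bar R) : 0 < c -> (c%:E * y < +oo)%E -> (y < +oo)%E.
Proof.
by move=> c0; case: y => [r _|+|_]; rewrite ?ltry ?ltNyy// gt0_muley ?lte_fin// ltxx.
Qed.

Section Finite.
Variable Q : R -> R.
Hypothesis Q_BUM : BUM Q.

Lemma beta1_ge0 : (beta1 Q < +oo)%E -> 0 <= fine (beta1 Q).
Proof.
move=> /ltey_pmul J_fin; apply: fine_ge0; rewrite mule_ge0// ?lee_fin ?invr_ge0//.
apply: (improper_stieltjes_ge0 Q_BUM ln_inv0); last by apply: J_fin; rewrite invr_gt0.
by move=> t t01; rewrite fine_ln_inv ?ln_invr_ge0//; case/andP: t01.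
Qed.

Let h t := sqrte (ln_inv t).

Lemma sqrt_ln_inv_ge0 t : 0 < t <= 1 -> 0 <= fine (h t).
Proof. by move=> /andP[t0 _]; rewrite fine_sqrt_ln_inv// sqrtr_ge0. Qed.

Lemma sqrt_ln_inv_nonincr t u : 0 < t -> t <= u -> u <= 1 -> fine (h u) <= fine (h t).
Proof.
move=> t0 tu u1; have u0 := lt_le_trans t0 tu.
rewrite !fine_sqrt_ln_inv//; apply: ler_wsqrtr.
by rewrite ler_ln ?posrE ?invr_gt0// lef_pV2.
Qed.

Lemma sqrt6_gt0 : 0 < Num.sqrt (6 : R).
Proof. by rewrite sqrtr_gt0. Qed.

Lemma beta2_improper_fin : (beta2 Q < +oo)%E -> (improper_stieltjes h Q < +oo)%E.
Proof. by apply: ltey_pmul; rewrite invr_gt0 sqrt6_gt0. Qed.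

Lemma sqrt_ln_inv0 : h 0 = +oo%E.
Proof. by rewrite /h ln_inv0. Qed.

Lemma beta2_ge0 : (beta2 Q < +oo)%E -> 0 <= fine (beta2 Q).
Proof.
move=> /beta2_improper_fin J_fin.
apply: fine_ge0; rewrite mule_ge0// ?lee_fin ?invr_ge0 ?sqrtr_ge0//.
exact: (improper_stieltjes_ge0 Q_BUM sqrt_ln_inv0 sqrt_ln_inv_ge0 J_fin).
Qed.

Lemma fine_beta2 : (beta2 Q < +oo)%E ->
  fine (beta2 Q) = (Num.sqrt 6)^-1 * fine (improper_stieltjes h Q).
Proof.
move=> /beta2_improper_fin J_fin; rewrite /beta2 fineM// ge0_fin_numE//.
exact: (improper_stieltjes_ge0 Q_BUM sqrt_ln_inv0 sqrt_ln_inv_ge0 J_fin).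
Qed.

End Finite.
End LogIntegrands.

(** * From moment generating functions to values at risk *)

Section SubGaussian.
Context {R : realType} {d : measure_display} {T : measurableType d}.
Context {P : probability T R} (Y : {RV P >-> R}).
Hypothesis Y_ge0 : forall y, y < 0 -> cdf Y y = 0%E.
Variables (M mu : R).
Hypothesis Y_le : cdf Y M = 1%E.

(* Chernoff's bound with the optimal exponent [12 s / c^2]. *)
Lemma VaR_le_subgaussian (c t : R) : 0 < c ->
  (forall l, 0 < l -> ('M_P Y l <= (expR (l * mu + l ^+ 2 * c ^+ 2 / 24))%:E)%E) ->
  0 < t < 1 -> VaR Y (1 - t) <= mu + c / Num.sqrt 6 * fine (sqrte (ln_inv t)).
Proof.
move=> c0 mgf /andP[t0 t1]; rewrite fine_sqrt_ln_inv//.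
have L0 : 0 < ln t^-1 by rewrite ln_gt0// invf_gt1.
set s := c / _ * _.
have s0 : 0 < s by rewrite mulr_gt0 ?divr_gt0 ?sqrt6_gt0 ?sqrtr_gt0.
have s2 : s ^+ 2 = c ^+ 2 * ln t^-1 / 6.
  by rewrite /s !exprMn exprVn !sqr_sqrtr ?(ltW L0)// mulrAC.
pose l := 12 * s / c ^+ 2.
have l0 : 0 < l by apply: divr_gt0; [apply: mulr_gt0|apply: exprn_gt0].
apply: VaR_le => //; first by lra.
rewrite cdf_1_ccdf EFinB leeB//.
apply: (@le_trans _ _ (P [set w | mu + s <= Y w]%R)).
  rewrite /ccdf /distribution /pushforward; apply: le_measure; rewrite ?inE.
  - exact: measurable_funPTI.
  - rewrite [X in measurable X](_ : _ = Y @^-1` `[mu + s, +oo[); first exact: measurable_funPTI.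
    by apply/seteqP; split => w /=; rewrite in_itv /= andbT.
  - by move=> w /=; rewrite in_itv /= andbT => /ltW.
apply: (le_trans (chernoff Y (mu + s) l0)).
apply: (le_trans (lee_wpmul2r _ (mgf l l0))); first by rewrite lee_fin expR_ge0.
(* At this [l] the exponent is [6 s^2 / c^2 - 12 s^2 / c^2 = - ln (1 / t)], so Chernoff's bound is
   exactly [t]. *)
rewrite -EFinM -expRD lee_fin (_ : _ + _ = - ln t^-1).
  by rewrite expRN lnK ?posrE ?invr_gt0// invrK.
have -> : ln t^-1 = 6 * s ^+ 2 / c ^+ 2 by rewrite s2; field; rewrite gt_eqF.
by rewrite /l; field; rewrite gt_eqF.
Qed.

End SubGaussian.

(** * The total cost of a fixed solution *)

Section TotalCost.
Context {R : realType} {d : measure_display} {T : measurableType d}.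
Context {P : probability T R} (n : nat) (C : 'I_n -> {RV P >-> R}).
Variables (lo up : 'I_n -> R) (x : 'rV[R]_n).
Hypothesis C_indep : independent_RVs C.
Hypothesis C_uniform : forall j, uniform_RV (C j) (lo j) (up j).
Hypothesis lo_ge0 : forall j, 0 <= lo j.
Hypothesis x_ge0 : forall j, 0 <= x 0 j.

Let Y := total_cost C x.

Lemma total_costE w : Y w = \sum_(j < n) x 0 j * C j w.
Proof. by rewrite /Y /total_cost mfun_sum. Qed.

Lemma meanE j : mean (C j) = (lo j + up j) / 2.
Proof. by rewrite /mean (uniform_RV_expectation (C_uniform j) (lo_ge0 j)). Qed.

Lemma expectation_total_cost : ('E_P[Y] = (\sum_(j < n) mean (C j) * x 0 j)%:E)%E.
Proof.
have -> : (Y : T -> R) = \sum_(f <- [seq x 0 j \o* C j | j <- index_enum 'I_n]) f.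
  apply/funext => w; rewrite total_costE big_map fct_sumE.
  by apply: eq_bigr => j _ /=; rewrite mulrC.
have L1 j : (C j : T -> R) \in Lfun P 1 by exact: uniform_RV_Lfun1.
rewrite expectation_sum; last by move=> f /mapP[j _ ->]; exact: Lfun_scale.
rewrite big_map -sumEFin; apply: eq_bigr => j _.
rewrite expectationZl// -(fineK (expectation_fin_num (L1 j))) -EFinM mulrC.
by rewrite /mean.
Qed.

(** An event of probability one on which the total cost is nonnegative and bounded. *)
Let box := \bigcap_(j in [set j | j \in [set: 'I_n]%SET]) C j @^-1` `[lo j, up j].

Let measurable_box : measurable box.
Proof. by apply: fin_bigcap_measurable => // j _; exact: measurable_funPTI. Qed.

Let P_box : P box = 1%E.
Proof.
rewrite [LHS]C_indep//; apply: big1 => j _; exact: uniform_RV_itv.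
Qed.

Let box_bounds w j : box w -> lo j <= C j w <= up j.
Proof. by move=> /(_ j); rewrite /= inE => /(_ isT); rewrite in_itv. Qed.

Lemma cdf_total_cost_lt0 y : y < 0 -> cdf Y y = 0%E.
Proof.
move=> y0; apply/eqP; rewrite eq_le cdf_ge0 andbT.
have PC : (P (~` box) = 0)%E.
  have -> : (P (~` box) = 1 - P box)%E by exact: probability_setC.
  by rewrite P_box subee.
rewrite -PC /cdf /distribution /pushforward; apply: le_measure; rewrite ?inE.
- exact: measurable_funPTI.
- exact: measurableC.
move=> w /=; rewrite in_itv /=; move=> + bw; apply/negP; rewrite -ltNge.
apply: (lt_le_trans y0); rewrite total_costE; apply: sumr_ge0 => j _.
by rewrite mulr_ge0//; have /andP[+ _] := box_bounds j bw; exact: le_trans.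
Qed.

Lemma cdf_total_cost_max : cdf Y (\sum_(j < n) x 0 j * up j) = 1%E.
Proof.
apply/eqP; rewrite eq_le cdf_le1 /= -P_box /cdf /distribution /pushforward.
apply: le_measure; rewrite ?inE//.
  exact: measurable_funPTI.
move=> w bw /=; rewrite in_itv /= total_costE; apply: ler_sum => j _.
by rewrite ler_wpM2l//; have /andP[] := box_bounds j bw.
Qed.

(** Independence factors the moment generating function; the factor of [C j] is bounded at the
    parameter [l * x 0 j], and the exponents add up. *)
Lemma mgf_total_cost_le (l : R) : 0 < l ->
  ('M_P Y l <= (expR (l * (\sum_(j < n) mean (C j) * x 0 j) +
    l ^+ 2 * (\sum_(j < n) (up j - lo j) ^+ 2 * x 0 j ^+ 2) / 24))%:E)%E.
Proof.
move=> l0; pose e j (y : R) := expR (l * x 0 j * y).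
pose B j := expR (l * (mean (C j) * x 0 j) + l ^+ 2 * ((up j - lo j) ^+ 2 * x 0 j ^+ 2) / 24).
have eB j : (\int[P]_w (e j (C j w))%:E <= (B j)%:E)%E.
  have := uniform_RV_mgf_le (C_uniform j) (mulr_ge0 (ltW l0) (x_ge0 j)).
  by congr (_ <= (expR _)%:E)%E; rewrite meanE; ring.
have e0 j y : 0 <= e j y by exact: expR_ge0.
have eint0 j : (0 <= \int[P]_w (e j (C j w))%:E)%E.
  by apply: integral_ge0 => w _; rewrite lee_fin.
have me j : measurable_fun [set: R] (e j).
  by apply: measurableT_comp => //; exact: mulrl_measurable.
have efin j : (\int[P]_w (e j (C j w))%:E)%E \is a fin_num.
  by rewrite ge0_fin_numE// (le_lt_trans (eB j))// ltry.
have -> : ('M_P Y l = \int[P]_w (\prod_(j < n) e j (C j w))%:E)%E.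
  rewrite /mmt_gen_fun unlock; apply: eq_integral => w _; congr EFin => /=.
  rewrite total_costE mulr_suml expR_sum; apply: eq_bigr => j _.
  by rewrite /e; congr expR; ring.
rewrite ge0_integral_prod_indep//.
have -> : (l * (\sum_(j < n) mean (C j) * x 0 j) +
    l ^+ 2 * (\sum_(j < n) (up j - lo j) ^+ 2 * x 0 j ^+ 2) / 24)%R =
    \sum_(j < n) (l * (mean (C j) * x 0 j) + l ^+ 2 * ((up j - lo j) ^+ 2 * x 0 j ^+ 2) / 24).
  by rewrite !mulr_sumr mulr_suml -big_split.
under eq_bigr do rewrite -(fineK (efin _)).
rewrite expR_sum prodEFin lee_fin; apply: ler_prod => j _.
by rewrite fine_ge0//= -lee_fin fineK//; exact: eB.
Qed.

Section Bounds.
Variable Q : R -> R.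
Hypothesis Q_BUM : BUM Q.
Hypothesis Q_concave : concave_unit Q.
Hypothesis beta2_fin : (beta2 Q < +oo)%E.

Let M := \sum_(j < n) x 0 j * up j.

Let Y_ge0 (y : R) : y < 0 -> cdf Y y = 0%E.
Proof. exact: cdf_total_cost_lt0. Qed.

Let Y_le : cdf Y M = 1%E.
Proof. exact: cdf_total_cost_max. Qed.

Lemma mean_le_distortion_risk :
  \sum_(j < n) mean (C j) * x 0 j <= distortion_risk Q Y.
Proof.
rewrite -lee_fin -expectation_total_cost.
apply: (expectation_le_distortion_risk Y_ge0 Y_le Q_BUM Q_concave).
exact: (improper_stieltjes_small_increments Q_BUM Q_concave sqrt_ln_inv0
  sqrt_ln_inv_ge0 (beta2_improper_fin beta2_fin)).
Qed.

(** The Chernoff bound is integrated for each [c] above [sqrt S], and [c] is then brought down to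
    [sqrt S]. *)
Lemma distortion_risk_le_subgaussian :
  distortion_risk Q Y <= \sum_(j < n) mean (C j) * x 0 j
    + fine (beta2 Q) * Num.sqrt (\sum_(j < n) (up j - lo j) ^+ 2 * x 0 j ^+ 2).
Proof.
have b0 := beta2_ge0 Q_BUM beta2_fin.
set mu := \sum_(j < n) mean (C j) * x 0 j; set S := \sum_(j < n) (up j - lo j) ^+ 2 * _.
have S0 : 0 <= S by apply: sumr_ge0 => j _; rewrite mulr_ge0 ?sqr_ge0.
(* [c] exceeds [sqrt S] since Chernoff's bound divides by it. *)
have H (c : R) : Num.sqrt S < c -> distortion_risk Q Y <= mu + c * fine (beta2 Q).
  move=> Sc; have c0 : 0 < c by exact: le_lt_trans Sc.
  rewrite fine_beta2// mulrA; apply: (distortion_risk_le Y_ge0 Y_le Q_BUM Q_concave).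
  - exact: sqrt_ln_inv0.
  - exact: sqrt_ln_inv_ge0.
  - exact: sqrt_ln_inv_nonincr.
  - exact: beta2_improper_fin.
  - by rewrite divr_ge0 ?sqrtr_ge0// ltW.
  move=> t t01; apply: (VaR_le_subgaussian Y_ge0) => // l l0.
  apply: (le_trans (mgf_total_cost_le l0)); rewrite lee_fin ler_expR lerD2l.
  rewrite ler_pM2r ?invr_gt0// ler_pM2l ?exprn_gt0// -/S -(sqr_sqrtr S0).
  by rewrite ler_sqr ?nnegrE ?sqrtr_ge0 ?ltW.
apply/ler_addgt0Pr => eps eps0.
have b1 : 0 < fine (beta2 Q) + 1 by rewrite ltr_wpDl.
(* This excess of [c] over [sqrt S] raises the bound by at most [eps], also when [beta2] is 0. *)
have := H (Num.sqrt S + eps / (fine (beta2 Q) + 1)).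
rewrite ltrDl divr_gt0// => /(_ isT) /le_trans; apply.
rewrite mulrDl addrA [Num.sqrt S * _]mulrC lerD2l mulrAC ler_pdivrMr//.
by rewrite ler_pM2l// lerDl.
Qed.

End Bounds.
End TotalCost.

(** * Approximation *)

Section Approximation.
Context {R : realType} (p : instance R) (gamma : R).
Let Q := @distortion R p.
Let w j := @c_up R p j - c_low j.
Hypothesis gamma_gt0 : 0 < gamma.
Hypothesis feasible_ge0 : forall x, @feasible R p x -> forall j, 0 <= x 0 j.
Hypothesis Q_BUM : BUM Q.
Hypothesis Q_concave : concave_unit Q.
Hypothesis cost_indep : independent_RVs (@cost R p).
Hypothesis cost_uniform : forall j : 'I_(nvar p), uniform_RV (cost j) (c_low j) (c_up j).
Hypothesis c_low_ge0 : forall j : 'I_(nvar p), 0 <= c_low j.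
Hypothesis c_hat_ge : forall j : 'I_(nvar p), gamma * w j <= c_hat j.
Hypothesis beta1_fin : (beta1 Q < +oo)%E.
Hypothesis beta2_fin : (beta2 Q < +oo)%E.

(** The chain runs from the risk of [x] through the surrogate objective at [(x, t)] and at
    [(y, W y)] to a multiple of the mean cost of [y], which is at most its risk. *)
Lemma surrogate_optimal_approx (x : 'rV[R]_(nvar p)) (t : R) :
  @surrogate_optimal R p x t -> forall y, @feasible R p y ->
  @risk_objective R p x <=
  (1 + (fine (beta1 Q) + fine (beta2 Q)) / gamma) * @risk_objective R p y.
Proof.
move=> [[xF xt] opt] y yF.
have b1 : 0 <= fine (beta1 Q) by exact: beta1_ge0.
have b2 : 0 <= fine (beta2 Q) by exact: beta2_ge0.
have w0 j : 0 <= w j by have [] := cost_uniform j; rewrite subr_ge0.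
have wz0 (z : 'rV[R]_(nvar p)) j : @feasible R p z -> 0 <= w j * z 0 j.
  by move=> zF; rewrite mulr_ge0// feasible_ge0.
(* The sum serves as [t] for a competitor: it dominates each [w j * z 0 j] and the root of their sum
   of squares, and is at most the mean cost over [gamma]. *)
pose W (z : 'rV[R]_(nvar p)) := \sum_j w j * z 0 j.
have risk_le (z : 'rV[R]_(nvar p)) (s : R) : @feasible R p z -> 0 <= s ->
    @risk_objective R p z <= @surrogate_objective R p z s.
  move=> zF s0.
  have := distortion_risk_le_subgaussian cost_indep cost_uniform c_low_ge0
    (feasible_ge0 zF) Q_BUM Q_concave beta2_fin.
  move=> /le_trans; apply; rewrite /surrogate_objective lerD2r lerDl.
  exact: mulr_ge0.
have risk_ge (z : 'rV[R]_(nvar p)) : @feasible R p z ->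
    \sum_j c_hat j * z 0 j <= @risk_objective R p z.
  move=> zF; exact: (mean_le_distortion_risk cost_indep cost_uniform c_low_ge0
    (feasible_ge0 zF) Q_BUM Q_concave beta2_fin).
have W_ge z j : @feasible R p z -> w j * z 0 j <= W z.
  by move=> zF; rewrite /W (bigD1 j)//= lerDl sumr_ge0// => k _; exact: wz0.
have W0 z : @feasible R p z -> 0 <= W z by move=> zF; apply: sumr_ge0 => j _; exact: wz0.
have x_le : @risk_objective R p x <= @surrogate_objective R p y (W y).
  (* Without variables no constraint forces [0 <= t], but then [x = y]; otherwise any one constraint
     does. *)
  have [n0|/lt0n_neq0] := posnP (nvar p).
    have -> : x = y by apply/rowP => j; have := leq_trans (ltn_ord j) (eq_leq n0).
    exact/risk_le/W0.
  rewrite -lt0n => n0; apply: (@le_trans _ _ (@surrogate_objective R p x t)).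
    by apply: risk_le => //; apply: le_trans (xt (Ordinal n0)); exact: wz0.
  by apply: opt; split => // j; exact: W_ge.
have sqrt_le : Num.sqrt (\sum_j w j ^+ 2 * y 0 j ^+ 2) <= W y.
  rewrite -[leRHS]ger0_norm ?W0// -sqrtr_sqr; apply: ler_wsqrtr.
  rewrite expr2 {1}/W mulr_suml; apply: ler_sum => j _.
  by rewrite -exprMn expr2; apply: ler_wpM2l; [exact: wz0|exact: W_ge].
have W_le : W y <= (\sum_j c_hat j * y 0 j) / gamma.
  rewrite ler_pdivlMr// /W mulr_suml; apply: ler_sum => j _.
  by rewrite mulrAC ler_wpM2r ?feasible_ge0// mulrC.
apply: (le_trans x_le); apply: (@le_trans _ _
    ((1 + (fine (beta1 Q) + fine (beta2 Q)) / gamma) * (\sum_j c_hat j * y 0 j))); last first.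
  by rewrite ler_wpM2l ?risk_ge// addr_ge0// divr_ge0 ?addr_ge0// ltW.
rewrite /surrogate_objective mulrDl mul1r -addrA lerD2l.
rewrite -mulrA [_^-1 * _]mulrC mulrDl lerD// ler_wpM2l//.
exact: le_trans W_le.
Qed.

End Approximation.

Theorem theorem6 (R : realType) (N : notation_system R) (gamma : R)
    (I : Type) (enc : I -> word) (inst : I -> instance R)
    (gamma_ge : 2^-1 <= gamma)
    (feasible_ge0 : forall i x, @feasible R (inst i) x -> forall j, 0 <= x 0 j)
    (distortion_BUM : forall i, BUM (distortion (inst i)))
    (distortion_concave : forall i, concave_unit (distortion (inst i)))
    (cost_indep : forall i, independent_RVs (@cost R (inst i)))
    (cost_uniform : forall i (j : 'I_(nvar (inst i))),
      uniform_RV (cost j) (c_low j) (c_up j))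
    (c_low_ge0 : forall i (j : 'I_(nvar (inst i))), 0 <= c_low j)
    (c_hat_ge : forall i (j : 'I_(nvar (inst i))),
      gamma * (c_up j - c_low j) <= c_hat j)
    (beta1_fin : forall i, (beta1 (distortion (inst i)) < +oo)%E)
    (beta2_fin : forall i, (beta2 (distortion (inst i)) < +oo)%E) :
  polytime_real N enc (fun i => fine (beta1 (distortion (inst i)))) ->
  polytime_real N enc (fun i => fine (beta2 (distortion (inst i)))) ->
  polytime_surrogate_optimal N enc inst ->
  approximable N enc (fun i => @feasible R (inst i))
    (fun i => @risk_objective R (inst i))
    (fun i => 1 + (fine (beta1 (distortion (inst i)))
                   + fine (beta2 (distortion (inst i)))) / gamma).

Proof.
move=> _ _; apply: polytime_computable_fst => i v [x [t [vx vt opt]]].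
have gamma_gt0 : 0 < gamma by rewrite (lt_le_trans _ gamma_ge)// invr_gt0.
exists x; split=> //; first by have [[]] := opt.
exact: (surrogate_optimal_approx gamma_gt0 (@feasible_ge0 i) _ _ _ _ _ _ _ _ opt).
Qed.
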